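(* Let $\Omega\subseteq\mathbb{R}^n$ be a bounded open set. Let $E\subseteq\mathbb{R}^{n+1}$ be a measurable set such that $E\setminus(\Omega\times\mathbb{R})$ is a subgraph and $$\Omega\times(-\infty,-M)\subseteq E\cap(\Omega\times\mathbb{R})\subseteq\Omega\times(-\infty,M)$$ for some $M>0$. Then $$\mathrm{Per}_s\big(\mathcal{S}_{w_E},\Omega\times(-M,M)\big)\le\mathrm{Per}_s\big(E,\Omega\times(-M,M)\big).$$ Furthermore, if $\mathrm{Per}_s(E,\Omega\times(-M,M))$ is finite, then the inequality is strict unless $E=\mathcal{S}_{w_E}$ up to a set of measure zero.
   Context: $n\ge1$ is an integer and $s\in(0,1)$. For measurable disjoint $A,B\subseteq\mathbb{R}^{n+1}$, $\mathcal{L}_s(A,B):=\int_A\int_B\frac{dX\,dY}{|X-Y|^{n+1+s}}$. With $\mathcal{C}E:=\mathbb{R}^{n+1}\setminus E$, for $E\subseteq\mathbb{R}^{n+1}$ measurable and $O\subseteq\mathbb{R}^{n+1}$ open, $$\mathrm{Per}_s(E,O):=\mathcal{L}_s(E\cap O,\mathcal{C}E\cap O)+\mathcal{L}_s(E\cap O,\mathcal{C}E\setminus O)+\mathcal{L}_s(E\setminus O,\mathcal{C}E\cap O).$$ For a function $w$ on $\mathbb{R}^n$, its subgraph is $\mathcal{S}_w:=\{(x,t)\in\mathbb{R}^n\times\mathbb{R}: t<w(x)\}$. ''$E\setminus(\Omega\times\mathbb{R})$ is a subgraph'' means that there is a measurable $v:\mathbb{R}^n\setminus\Omega\to\mathbb{R}$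 with $E\setminus(\Omega\times\mathbb{R})=\{(x,t)\in(\mathbb{R}^n\setminus\Omega)\times\mathbb{R}: t<v(x)\}$. The vertical rearrangement of $E$ is $\mathcal{S}_{w_E}$, where $$w_E(x):=\lim_{R\to+\infty}\left(\int_{-R}^R\chi_E(x,t)\,dt-R\right)\quad\text{for } x\in\mathbb{R}^n.$$ *)

(* Defs.v *)
From HB Require Import structures.
From mathcomp Require Import all_boot all_order all_algebra.
From mathcomp Require Import all_classical all_reals all_analysis.
Import Order.TTheory GRing.Theory Num.Theory.
Import numFieldTopology.Exports numFieldNormedType.Exports.

Set Implicit Arguments.
Unset Strict Implicit.
Unset Printing Implicit Defensive.

Local Open Scope classical_set_scope.
Local Open Scope ring_scope.

(* R^n is 'rV[R]_n, with the library's topology, and R^(n+1) is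
   'rV[R]_n * R, a point being X = (x, t).  The library has no Lebesgue
   measure in dimension n: we build it on the product sigma-algebra of
   'rV[R]_n by iterating the library's product measure \x, and complete it
   with the library's completed_measure_extension, so that "measurable" means
   Lebesgue measurable throughout. *)

Definition measure_rV_display : measure_display.
Proof. by constructor. Qed.

Section measurable_rV.
Context {R : realType} {n : nat}.

Let coor (i : 'I_n) (x : 'rV[R]_n) : measurableTypeR R := x ord0 i.

Let rV_set0 : g_sigma_preimage coor set0.
Proof. exact: sigma_algebra0. Qed.

Let rV_setC A : g_sigma_preimage coor A -> g_sigma_preimage coor (~` A).
Proof. exact: sigma_algebraC. Qed.

Let rV_bigcup (F : _^nat) : (forall i, g_sigma_preimage coor (F i)) ->
  g_sigma_preimage coor (\bigcup_i (F i)).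
Proof. exact: sigma_algebra_bigcup. Qed.

HB.instance Definition _ := @isMeasurable.Build measure_rV_display
  'rV[R]_n (g_sigma_preimage coor) rV_set0 rV_setC rV_bigcup.

End measurable_rV.

Lemma measurable_fun_rVP d (T : measurableType d) (R : realType) n
    (f : T -> 'rV[R]_n) :
  (forall i, measurable_fun [set: T]
    ((fun x => f x ord0 i) : T -> measurableTypeR R)) ->
  measurable_fun [set: T] f.
Proof.
move=> mf; apply: (@measurability _ _ _ _ _ _
  (\big[setU/set0]_(i < n) preimage_set_system setT
    (fun x : 'rV[R]_n => x ord0 i : measurableTypeR R) measurable)) => //.
move=> _ [A + <-].
rewrite -bigcup_seq => -[i _ [B mB <-]].
by rewrite setTI; exact: (mf i).
Qed.

Lemma measurable_coor (R : realType) n (i : 'I_n) :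
  measurable_fun [set: 'rV[R]_n]
    ((fun x => x ord0 i) : 'rV[R]_n -> measurableTypeR R).
Proof.
move=> _ Y mY; rewrite setTI; apply: sub_sigma_algebra => /=.
rewrite -bigcup_seq/=; exists i => /=; first by rewrite mem_index_enum.
by exists Y => //; rewrite setTI.
Qed.

Lemma sigma_finite_product d1 d2 (T1 : measurableType d1)
    (T2 : measurableType d2) (R : realType)
    (m1 : {sigma_finite_measure set T1 -> \bar R})
    (m2 : {sigma_finite_measure set T2 -> \bar R}) :
  sigma_finite [set: T1 * T2] (m1 \x m2)%E.
Proof.
have /sigma_finiteP[F [TF ndF Foo]] := sigma_finiteT m1.
have /sigma_finiteP[G [TG ndG Goo]] := sigma_finiteT m2.
exists (fun n => F n `*` G n).
  rewrite -setXTT TF TG predeqE => -[x y]; split.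
    move=> [/= [n _ Fnx] [k _ Gky]]; exists (maxn n k) => //; split.
    - by move: x Fnx; exact/subsetPset/ndF/leq_maxl.
    - by move: y Gky; exact/subsetPset/ndG/leq_maxr.
  by move=> [n _ []/= ? ?]; split; exists n.
move=> k; have [? ?] := Foo k; have [? ?] := Goo k.
split; first exact: measurableX.
by rewrite product_measure1E// lte_mul_pinfty// ge0_fin_numE.
Qed.

Section cons_rV.
Context {R : realType} {n : nat}.

Definition cons_rV (z : measurableTypeR R * 'rV[R]_n) : 'rV[R]_n.+1 :=
  row_mx (const_mx z.1 : 'rV[R]_1) z.2.

Definition uncons_rV (x : 'rV[R]_n.+1) : measurableTypeR R * 'rV[R]_n :=
  (x ord0 ord0, rsubmx (x : 'rV[R]_(1 + n))).

Lemma cons_rV0 z : cons_rV z ord0 ord0 = z.1.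
Proof.
rewrite (_ : ord0 = lshift n (ord0 : 'I_1)); last exact/val_inj.
by rewrite (row_mxEl (const_mx z.1 : 'rV[R]_1)) mxE.
Qed.

Lemma cons_rVS z (i : 'I_n) : cons_rV z ord0 (lift ord0 i) = z.2 ord0 i.
Proof.
rewrite (_ : lift ord0 i = rshift 1 i); last exact/val_inj.
by rewrite (row_mxEr (const_mx z.1 : 'rV[R]_1)); congr (z.2 _ _); exact/val_inj.
Qed.

Lemma cons_rVK : cancel cons_rV uncons_rV.
Proof.
move=> [a x]; rewrite /uncons_rV cons_rV0; congr (_, _).
by rewrite /cons_rV row_mxKr.
Qed.

Lemma measurable_cons_rV : measurable_fun [set: _] cons_rV.
Proof.
apply: measurable_fun_rVP => i; have [j ->|->] := unliftP ord0 i.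
  rewrite (_ : (fun _ => _) =
      (fun x : 'rV[R]_n => x ord0 j : measurableTypeR R) \o snd).
    by apply: measurableT_comp; [exact: measurable_coor|exact: measurable_snd].
  by apply/funext => z; exact: cons_rVS.
rewrite (_ : (fun _ => _) = fst); first exact: measurable_fst.
by apply/funext => z; exact: cons_rV0.
Qed.

Lemma measurable_uncons_rV : measurable_fun [set: _] uncons_rV.
Proof.
apply/measurable_fun_pairP; split; first exact: measurable_coor.
apply: measurable_fun_rVP => i.
rewrite (_ : (fun _ => _) =
    (fun x : 'rV[R]_n.+1 => x ord0 (rshift 1 i) : measurableTypeR R)).
  exact: measurable_coor.
by apply/funext => x /=; rewrite mxE.
Qed.

Variable mu : {sigma_finite_measure set 'rV[R]_n -> \bar R}.

Definition cons_measure : set 'rV[R]_n.+1 -> \bar R :=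
  pushforward (@lebesgue_measure R \x mu)%E cons_rV.

Let mcons (A : set 'rV[R]_n.+1) : measurable A -> measurable (cons_rV @^-1` A).
Proof. by move=> mA; rewrite -[X in measurable X]setTI; exact: measurable_cons_rV. Qed.

Let cons_measure0 : cons_measure set0 = 0%E.
Proof. by rewrite /cons_measure /pushforward preimage_set0 measure0. Qed.

Let cons_measure_ge0 A : (0 <= cons_measure A)%E.
Proof. by rewrite /cons_measure /pushforward; exact: measure_ge0. Qed.

Let cons_measure_sigma_additive : semi_sigma_additive cons_measure.
Proof.
move=> F mF tF mUF; rewrite /cons_measure /pushforward preimage_bigcup.
apply: measure_semi_sigma_additive.
- by move=> k; exact: mcons.
- apply/trivIsetP => /= i j _ _ ij; rewrite -preimage_setI.
  by move/trivIsetP : tF => /(_ _ _ _ _ ij) ->//; rewrite preimage_set0.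
- by rewrite -preimage_bigcup; exact: mcons.
Qed.

HB.instance Definition _ := isMeasure.Build _ _ _ cons_measure
  cons_measure0 cons_measure_ge0 cons_measure_sigma_additive.

Let cons_measure_sigma_finite : sigma_finite setT cons_measure.
Proof.
have [F FT Foo] := sigma_finite_product (@lebesgue_measure R) mu.
exists (fun k => uncons_rV @^-1` F k).
  by rewrite -preimage_bigcup -FT preimage_setT.
move=> k; split.
  by rewrite -[X in measurable X]setTI; apply: measurable_uncons_rV => //; exact: (Foo k).1.
rewrite /cons_measure /pushforward -comp_preimage.
rewrite (_ : uncons_rV \o cons_rV = id); first exact: (Foo k).2.
by apply/funext => z; exact: cons_rVK.
Qed.

HB.instance Definition _ := Measure_isSigmaFinite.Build _ _ _ cons_measure
  cons_measure_sigma_finite.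

End cons_rV.

Fixpoint lebesgue_measure_rV (R : realType) (n : nat) :
    {sigma_finite_measure set 'rV[R]_n -> \bar R} :=
  match n with
  | 0 => @dirac _ 'rV[R]_0 0 R
  | m.+1 => cons_measure (lebesgue_measure_rV R m)
  end.

Lemma measurable_rV_box (R : realType) n
    (A : 'I_n -> set (measurableTypeR R)) :
  (forall i, measurable (A i)) ->
  measurable [set x : 'rV[R]_n | forall i, A i (x ord0 i)].
Proof.
move=> mA; rewrite (_ : mkset _ = \bigcap_(i in setT)
    ((fun x : 'rV[R]_n => x ord0 i : measurableTypeR R) @^-1` A i)).
  apply: (@fin_bigcap_measurable _ 'rV[R]_n 'I_n) => [|i _].
    exact: (@finite_finset 'I_n).
  by rewrite -[X in measurable X]setTI; exact: measurable_coor.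
by apply/seteqP; split => x /= Ax i; [move=> _; exact: Ax|exact: (Ax i Logic.I)].
Qed.

Lemma lebesgue_measure_rV_box (R : realType) n
    (A : 'I_n -> set (measurableTypeR R)) :
  (forall i, measurable (A i)) ->
  lebesgue_measure_rV R n [set x | forall i, A i (x ord0 i)] =
  (\prod_(i < n) lebesgue_measure (A i))%E.
Proof.
elim: n A => [A _|n IH A mA].
  rewrite big_ord0 (_ : [set _ | _] = setT) /= ?diracT//.
  by apply/seteqP; split => // x _ [].
have mB := measurable_rV_box (fun i => mA (lift ord0 i)).
rewrite big_ord_recl -IH// -product_measure1E//= /cons_measure /pushforward.
congr (_ _); apply/seteqP; split => -[a x] /= => [Ax|[Aa Ax] i].
  split=> [|i]; first by have := Ax ord0; rewrite cons_rV0.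
  by have := Ax (lift ord0 i); rewrite cons_rVS.
by have [j ->|->] := unliftP ord0 i; rewrite ?cons_rVS ?cons_rV0//; exact: Ax.
Qed.

Section completed.
Variables (R : realType) (n : nat).

Definition lebesgue_measure_rVR :
    set ('rV[R]_n * measurableTypeR R)%type -> \bar R :=
  (lebesgue_measure_rV R n \x @lebesgue_measure R)%E.
HB.instance Definition _ := Measure.on lebesgue_measure_rVR.
HB.instance Definition _ := Measure_isSigmaFinite.Build _ _ _
  lebesgue_measure_rVR (sigma_finite_product (lebesgue_measure_rV R n) _).

Definition completed_lebesgue_measure_rVR : set _ -> \bar R :=
  @completed_measure_extension _ _ _ lebesgue_measure_rVR.
HB.instance Definition _ := Measure.on completed_lebesgue_measure_rVR.

End completed.
Arguments lebesgue_measure_rVR : clear implicits.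
Arguments completed_lebesgue_measure_rVR : clear implicits.

Section perimeter.
Context {R : realType} {n : nat}.
Implicit Types (X Y : 'rV[R]_n * R) (A B E O : set ('rV[R]_n * R)).

Definition euclidean_dist X Y : R :=
  Num.sqrt ((\sum_(i < n) (X.1 ord0 i - Y.1 ord0 i) ^+ 2) + (X.2 - Y.2) ^+ 2).

(* L_s(A, B); the library's inverse makes the integrand 0 on the diagonal
   X = Y, which does not meet A * B for disjoint A and B. *)
Definition interaction (s : R) A B : \bar R :=
  (\int[completed_lebesgue_measure_rVR R n]_(X in A)
   \int[completed_lebesgue_measure_rVR R n]_(Y in B)
     ((euclidean_dist X Y `^ (n%:R + 1 + s))^-1)%:E)%E.

Definition Per (s : R) E O : \bar R :=
  (interaction s (E `&` O) (~` E `&` O)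
   + interaction s (E `&` O) (~` E `\` O)
   + interaction s (E `\` O) (~` E `&` O))%E.

Definition subgraph (w : 'rV[R]_n -> R) : set ('rV[R]_n * R) :=
  [set X | X.2 < w X.1].

(* The function w_E. *)
Definition vertical_height E (x : 'rV[R]_n) : R :=
  lim ((\int[completed_lebesgue_measure]_(t in `[- r, r]) \1_E (x, t)) - r
       @[r --> +oo]).

(* v is a total function; only its values outside Omega are constrained. *)
Definition is_subgraph_outside E (Omega : set 'rV[R]_n) : Prop :=
  exists2 v : 'rV[R]_n -> R,
    measurable_fun
      (~` Omega : set (caratheodory_type (lebesgue_measure_rV R n)^*%mu)) v &
    E `\` (Omega `*` setT) = (~` Omega `*` setT) `&` subgraph v.

Definition lebesgue_measurable E : Prop :=
  (lebesgue_measure_rVR R n)^*%mu.-cara.-measurable E.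

Definition ae_equal E F : Prop :=
  (completed_lebesgue_measure_rVR R n).-negligible ((E `\` F) `|` (F `\` E)).

End perimeter.

(* Main.v *)
Require Import Defs.
From HB Require Import structures.
From mathcomp Require Import all_boot all_order all_algebra.
From mathcomp Require Import all_classical all_reals all_analysis.
From mathcomp Require Import lra measurable_realfun.
Import Order.TTheory GRing.Theory Num.Theory.
Import numFieldTopology.Exports numFieldNormedType.Exports.

(* Substituting tau = t - h in the inner integral and exchanging integrals,
   Per(E, O) becomes the integral over (x, y, h) of the kernel times the length
   of the set of t such that t is in E_x, t - h is not in E_y, and t is in O_x
   or t - h is in O_y.  Adding the length of those t for which neither t nor
   t - h is in O, which the rearrangement does not change because it only moves
   mass inside O, one gets |E_x \ (E_y + h)|.  Let w denote the height.  As
     |E_x \ (E_y + h)| - |(E_y + h) \ E_x| = w(x) - w(y) - h,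
   the first term is at least the positive part of the right-hand side, which is
   its value for the subgraph of w.  The inequality thus holds under the
   integral, whatever the kernel.  For the equality case it is enough to take y
   outside Omega, where E_y is already a half-line: if E_x is not a half-line,
   then E_x and a half-line with end point close to w(x) each have a part of
   positive length outside the other, so that the inequality is strict for a set
   of h of positive measure. *)

Set Implicit Arguments.
Unset Strict Implicit.
Unset Printing Implicit Defensive.

Local Open Scope classical_set_scope.
Local Open Scope ring_scope.

(** * Subsets of the line that are half-lines up to finite measure *)

Section excess.
Local Open Scope ereal_scope.
Context d (T : measurableType d) (R : realType) (m : {measure set T -> \bar R}).
Implicit Types A B C D : set T.

Lemma measure_setY A B : measurable A -> measurable B ->
  m (A `+` B) = m (A `\` B) + m (B `\` A).
Proof.
move=> mA mB; rewrite measureU//; try exact: measurableD.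
by apply/seteqP; split => x //= [[Ax _] []].
Qed.

Lemma eq_measure_setY0 A B : measurable A -> measurable B ->
  m (A `+` B) = 0 -> m A = m B.
Proof.
move=> mA mB; rewrite measure_setY// => /eqP.
rewrite padde_eq0// => /andP[/eqP AB0 /eqP BA0].
have mDI X Y : measurable X -> measurable Y ->
  m X = m (X `\` Y) + m (X `&` Y) by exact: measureDI.
by rewrite (mDI A B)// (mDI B A)// AB0 BA0 setIC.
Qed.

(** This plays the role of m(A) - m(B) when both measures may be infinite. Since [fine] sends +oo to
    0, the value is meaningful for commensurable sets only. *)
Definition excess A B : R := (fine (m (A `\` B)) - fine (m (B `\` A)))%R.

Definition commensurable A B :=
  [/\ measurable A, measurable B, m (A `\` B) < +oo & m (B `\` A) < +oo].

Lemma commensurableC A B : commensurable A B -> commensurable B A.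
Proof. by case. Qed.

Lemma excessC A B : excess B A = (- excess A B)%R.
Proof. by rewrite /excess opprB. Qed.

Lemma measure_setD_pieces A B C : measurable A -> measurable B ->
  measurable C ->
  m (A `\` B) = m (A `\` B `\` C) + m ((A `\` B) `&` C).
Proof. by move=> mA mB mC; apply: measureDI => //; exact: measurableD. Qed.

Lemma commensurable_trans A B C :
  commensurable A B -> commensurable B C -> commensurable A C.
Proof.
move=> [mA mB AB BA] [_ mC BC CB]; split => //.
  apply: (@le_lt_trans _ _ (m ((A `\` B) `|` (B `\` C)))).
    apply: le_measure; rewrite ?inE//; first exact: measurableD.
      by apply: measurableU; exact: measurableD.
    by move=> x [Ax Cx]; have [Bx|Bx] := pselect (B x); [right|left].
  apply: le_lt_trans (measureU2 _ _ _) _; try exact: measurableD.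
  exact: lte_add_pinfty.
apply: (@le_lt_trans _ _ (m ((C `\` B) `|` (B `\` A)))).
  apply: le_measure; rewrite ?inE//; first exact: measurableD.
    by apply: measurableU; exact: measurableD.
  by move=> x [Ax Cx]; have [Bx|Bx] := pselect (B x); [right|left].
apply: le_lt_trans (measureU2 _ _ _) _; try exact: measurableD.
exact: lte_add_pinfty.
Qed.

(** Cutting each of the six differences along the third set gives twelve pieces, which are six sets
    of finite measure occurring twice each; the identity is then linear arithmetic. *)
Lemma excess_trans A B C : commensurable A B -> commensurable B C ->
  (excess A B + excess B C = excess A C)%R.
Proof.
move=> cAB cBC; have [mA _ AC CA] := commensurable_trans cAB cBC.
have [_ mB AB BA] := cAB; have [_ mC BC CB] := cBC.
have piece X Y Z : measurable X -> measurable Y -> measurable Z ->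
    m (X `\` Y) < +oo ->
    (fine (m (X `\` Y)) =
      fine (m (X `\` Y `\` Z)) + fine (m ((X `\` Y) `&` Z)))%R.
  move=> mX mY mZ XY; rewrite -fineD -?measure_setD_pieces//.
    rewrite ge0_fin_numE// (le_lt_trans _ XY)// le_measure ?inE//.
      by apply: measurableD => //; exact: measurableD.
    exact: measurableD.
  rewrite ge0_fin_numE// (le_lt_trans _ XY)// le_measure ?inE//.
    by apply: measurableI => //; exact: measurableD.
  exact: measurableD.
rewrite /excess (piece A B C)// (piece B A C)// (piece B C A)// (piece C B A)//.
rewrite (piece A C B)// (piece C A B)//.
rewrite (_ : A `\` C `\` B = A `\` B `\` C); last first.
  by apply/seteqP; split => x [[]].
rewrite (_ : C `\` A `\` B = C `\` B `\` A); last first.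
  by apply/seteqP; split => x [[]].
rewrite (_ : B `\` C `\` A = B `\` A `\` C); last first.
  by apply/seteqP; split => x [[]].
rewrite (_ : (C `\` B) `&` A = (A `\` B) `&` C); last first.
  by apply/seteqP; split => x [[]].
rewrite (_ : (C `\` A) `&` B = (B `\` A) `&` C); last first.
  by apply/seteqP; split => x [[]].
rewrite (_ : (A `\` C) `&` B = (B `\` C) `&` A); last first.
  by apply/seteqP; split => x [[]].
lra.
Qed.

End excess.

(** * Translates, rays and heights on the line *)

Section vertical_translation.
Context {R : realType}.
Notation lam := (@lebesgue_measure R).
Implicit Types (A B : set (measurableTypeR R)) (a b h : R).

Definition vshift h A : set (measurableTypeR R) := [set t | A (t - h)].

Lemma measurable_vshift h A : measurable A -> measurable (vshift h A).
Proof.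
move=> mA; rewrite -[vshift h A]setTI.
have -> : vshift h A = (fun t : measurableTypeR R => t - h : measurableTypeR R) @^-1` A by [].
have : measurable_fun [set: measurableTypeR R]
    (fun t : measurableTypeR R => t - h : measurableTypeR R).
  by apply: measurable_funB => //; exact: measurable_id.
exact.
Qed.

(** By uniqueness of Lebesgue measure, it is enough to compare the image measure with it on the
    intervals []a, b]]. *)
Lemma lebesgue_measure_vshift h A : measurable A -> lam (vshift h A) = lam A.
Proof.
pose f (t : measurableTypeR R) : measurableTypeR R := t - h.
have mf : measurable_fun setT f.
  by apply: measurable_funB => //; exact: measurable_id.
pose mf_mixin := isMeasurableFun.Build _ _ _ _ _ mf.
pose F : {mfun _ >-> _} := HB.pack f mf_mixin.
move=> mA; apply/esym.
apply: (@lebesgue_measure_unique R (pushforward lam F)) => //.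
move=> _ [[a b]] _ <-.
transitivity (lam `](a + h), (b + h)]).
  rewrite !lebesgue_measure_itv/= !lte_fin ltrD2r.
  by case: ifP => // _; rewrite -!EFinB; congr EFin; lra.
congr (lam _); apply/seteqP; split => t.
  by rewrite /= !in_itv/= /f ltrBrDr lerBlDr.
by rewrite /= !in_itv/= /f ltrBrDr lerBlDr.
Qed.

Definition ray a : set (measurableTypeR R) := `]-oo, a[%classic.

Lemma measurable_ray a : measurable (ray a).
Proof. exact: measurable_itv. Qed.
Hint Resolve measurable_ray : core.

Lemma vshift_ray h a : vshift h (ray a) = ray (a + h).
Proof. by apply/seteqP; split => t; rewrite /vshift /ray/= !in_itv/= ltrBlDr. Qed.

Lemma ray_setD a b : ray a `\` ray b = `[b, a[%classic.
Proof.
apply/seteqP; split => t; rewrite /ray /= !in_itv/=.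
  by move=> [-> /negP]; rewrite -leNgt => ->.
by move=> /andP[bt ->]; split => //; apply/negP; rewrite -leNgt.
Qed.

Lemma lebesgue_measure_rayD a b : lam (ray a `\` ray b) = (Num.max (a - b) 0)%:E.
Proof.
rewrite ray_setD lebesgue_measure_itv/= lte_fin -EFinB.
by case: ltP => ba; congr EFin; apply/esym; [apply/max_idPl|apply/max_idPr]; lra.
Qed.

Lemma commensurable_ray a b : commensurable lam (ray a) (ray b).
Proof. by split => //=; rewrite lebesgue_measure_rayD ltry. Qed.

Lemma excess_ray a b : excess lam (ray a) (ray b) = a - b.
Proof.
rewrite /excess/= !lebesgue_measure_rayD/=.
by case: leP => ?; case: leP => ?; lra.
Qed.

(* [height A] is the length of A in [0, +oo[ minus the length of the complement of
   A in ]-oo, 0[, that is, the value of w_E at a point with vertical slice [A]. *)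
Definition raylike A := commensurable lam A (ray 0).
Definition height A := excess lam A (ray 0).

Lemma raylike_ray a : raylike (ray a).
Proof. exact: commensurable_ray. Qed.

Lemma height_ray a : height (ray a) = a.
Proof. by rewrite /height excess_ray subr0. Qed.

Lemma raylike_commensurable A B : raylike A -> raylike B ->
  commensurable lam A B.
Proof. by move=> rA /commensurableC; exact: commensurable_trans. Qed.

Lemma excess_raylike A B : raylike A -> raylike B ->
  excess lam A B = height A - height B.
Proof.
move=> rA rB; rewrite -(excess_trans rA (commensurableC rB)).
by rewrite /height (excessC _ B).
Qed.

Lemma vshift_setD h A B : vshift h A `\` vshift h B = vshift h (A `\` B).
Proof. by []. Qed.

Lemma raylike_vshift h A : raylike A -> raylike (vshift h A).
Proof.
move=> [mA _ A0 A1]; apply: (@commensurable_trans _ _ _ _ _ (vshift h (ray 0))).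
  split; rewrite /= ?vshift_setD ?lebesgue_measure_vshift//;
    by [exact: measurable_vshift|exact: measurableD].
by rewrite vshift_ray; exact: commensurable_ray.
Qed.

Lemma height_vshift h A : raylike A -> height (vshift h A) = height A + h.
Proof.
move=> rA; have [mA _ A0 A1] := rA.
have r0 := raylike_vshift h (raylike_ray 0).
have := excess_raylike (raylike_vshift h rA) r0.
rewrite {2}vshift_ray height_ray add0r => /eqP; rewrite eq_sym subr_eq => /eqP ->.
by rewrite /height /excess/= !vshift_setD !lebesgue_measure_vshift//;
  exact: measurableD.
Qed.

Lemma lebesgue_measure_raylikeD A B : raylike A -> raylike B ->
  (lam (A `\` B) = (height A - height B)%:E + lam (B `\` A))%E.
Proof.
move=> rA rB; rewrite -excess_raylike//.
have [_ _ AB BA] := raylike_commensurable rA rB.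
rewrite /excess/= EFinB !fineK ?ge0_fin_numE// subeK// ge0_fin_numE//.
Qed.

(** For rays the measure is the positive part of the difference of heights. When the difference is
    nonnegative, [lebesgue_measure_raylikeD] gives the bound on dropping the measure of B \ A. *)
Lemma le_lebesgue_measure_rayD A B : raylike A -> raylike B ->
  (lam (ray (height A) `\` ray (height B)) <= lam (A `\` B))%E.
Proof.
move=> rA rB; rewrite lebesgue_measure_rayD /Num.max; case: ifP => // _.
by rewrite lebesgue_measure_raylikeD// leeDl.
Qed.

(** Put a = [height A]. As A and [ray a] have the same height, the two differences between them have
    the same measure, which is positive by hypothesis; this measure is e. For b < a, equality would
    put almost all of [ray b] in A, so that the part of [ray a] outside A would have measure at most
    a - b < e. *)
Lemma lt_lebesgue_measure_rayD A : raylike A ->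
  lam (A `+` ray (height A)) != 0%E ->
  exists2 e, 0 < e & forall b, height A - e < b < height A ->
  (lam (ray (height A) `\` ray b) < lam (A `\` ray b))%E.
Proof.
move=> rA; set a := height A; have [mA _ _ _] := rA.
have ra := raylike_ray a.
have [_ _ Aa aA] := raylike_commensurable rA ra.
have AaaA : lam (A `\` ray a) = lam (ray a `\` A).
  by rewrite lebesgue_measure_raylikeD// height_ray subrr add0e.
rewrite measure_setY//= AaaA => e0.
have {}e0 : (0 < lam (ray a `\` A))%E.
  by rewrite lt0e measure_ge0 andbT; apply: contra e0 => /eqP ->; rewrite adde0.
have ef : lam (ray a `\` A) \is a fin_num by rewrite ge0_fin_numE.
exists (fine (lam (ray a `\` A))).
  by rewrite fine_gt0// e0 -ge0_fin_numE.
move=> b /andP[eb ba].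
have maxab : Num.max (a - b) 0 = a - b by apply/max_idPl; rewrite subr_ge0 ltW.
rewrite (lebesgue_measure_raylikeD rA (raylike_ray b)) height_ray -/a.
rewrite lebesgue_measure_rayD maxab.
rewrite -[ltLHS]adde0 lteD2lE//.
rewrite lt0e measure_ge0 andbT; apply/eqP => b0.
have : (lam (ray a `\` A) <= lam (ray b `\` A) + lam (ray a `\` ray b))%E.
  apply: le_trans (measureU2 _ _ _); try exact: measurableD.
  apply: le_measure; rewrite ?inE.
  - exact: measurableD.
  - by apply: measurableU; exact: measurableD.
  - by move=> x [ax Ax]; have [bx|bx] := pselect (ray b x); [left|right].
rewrite b0 add0e lebesgue_measure_rayD maxab.
move=> leb; have : fine (lam (ray a `\` A)) <= a - b by rewrite -lee_fin fineK.
by move: eb; lra.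
Qed.

End vertical_translation.
#[export] Hint Resolve measurable_ray : core.

(** * Completion of a sigma-finite measure *)

Section completion.
Local Open Scope ereal_scope.
Context d (T : measurableType d) (R : realType)
  (m : {sigma_finite_measure set T -> \bar R}).
Notation mext := (m^*)%mu.
Notation cm := (@completed_measure_extension _ _ _ m).
Implicit Types A B C : set T.

Lemma cara_measurable A : measurable A -> mext.-cara.-measurable A.
Proof. exact: caratheodory_measurable_mu_ext. Qed.

Let mextE A : measurable A -> mext A = m A.
Proof. exact: (measurable_mu_extE m). Qed.

(** The hull is a countable intersection of countable unions of measurable sets that cover A, with
    measures within 1/(k+1) of the infimum; the whole space serves when the outer measure is
    infinite. *)
Lemma outer_measure_hull A :
  exists B, [/\ measurable B, A `<=` B & m B = mext A].
Proof.
have [Aoo|] := eqVneq (mext A) +oo.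
  exists setT; split => //; apply/eqP; rewrite eq_le Aoo leey/= -Aoo.
  by rewrite -mextE//; exact: le_outer_measure.
rewrite -ltey => Afin.
have cov k : exists B, [/\ measurable B, A `<=` B &
    m B <= mext A + (k.+1%:R^-1)%:E].
  have : mext A \is a fin_num by rewrite ge0_fin_numE// outer_measure_ge0.
  have k0 : (0 < k.+1%:R^-1 :> R)%R by rewrite invr_gt0.
  move=> /(lb_ereal_inf_adherent k0)[_ [F [mF AF] <-]] FA.
  exists (\bigcup_i F i); split => //; first exact: bigcupT_measurable.
  rewrite (le_trans _ (ltW FA))// -mextE; last first.
    exact: bigcupT_measurable.
  apply: (le_trans (outer_measure_sigma_subadditive mext F)).
  by apply: lee_nneseries => // i _; rewrite [leLHS]mextE.
have /choice[B PB] := cov.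
exists (\bigcap_k B k); split.
- by apply: bigcapT_measurable => k; case: (PB k).
- by move=> x Ax k _; case: (PB k) => _ + _; exact.
- have mB : measurable (\bigcap_k B k).
    by apply: bigcapT_measurable => k; case: (PB k).
  apply/eqP; rewrite eq_le; apply/andP; split; last first.
    rewrite -mextE//; apply: le_outer_measure.
    by move=> x Ax k _; case: (PB k) => _ + _; exact.
  apply/lee_addgt0Pr => _/posnumP[e]; near \oo => k.
  apply: (@le_trans _ _ (m (B k))).
    rewrite le_measure ?inE//; first by case: (PB k).
    exact: bigcap_inf.
  case: (PB k) => _ _ /le_trans; apply.
  rewrite leeD2l// lee_fin ltW//; near: k; exact: near_infty_natSinv_lt.
Unshelve. all: by end_near. Qed.

Lemma negligible_completed A : cm.-negligible A ->
  exists B, [/\ measurable B, m B = 0 & A `<=` B].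
Proof.
move=> [B [_ B0 AB]]; have [C [mC AC C0]] := outer_measure_hull A.
exists C; split => //; rewrite C0; apply/eqP; rewrite eq_le.
by rewrite outer_measure_ge0 andbT -B0; exact: le_outer_measure.
Qed.

(** Hulls are taken on the pieces of an exhaustion by sets of finite measure, because subtracting
    the measure of a set from that of its hull requires finiteness. The null excesses are enclosed
    in measurable null sets and united. *)
Lemma cara_measurable_regular A : mext.-cara.-measurable A ->
  exists B N, [/\ measurable B, measurable N, m N = 0, A `<=` B &
    B `\` A `<=` N].
Proof.
move=> mA; have /sigma_finiteP[F [TF _ Foo]] := sigma_finiteT m.
have reg i : exists BN : set T * set T,
    [/\ measurable BN.1, measurable BN.2, m BN.2 = 0, A `&` F i `<=` BN.1 &
      BN.1 `\` (A `&` F i) `<=` BN.2].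
  have [mF Fi] := Foo i.
  have [B [mB AB B1]] := outer_measure_hull (A `&` F i).
  have mAF : mext.-cara.-measurable (A `&` F i).
    by apply: measurableI => //; exact: cara_measurable.
  have AFoo : mext (A `&` F i) < +oo.
    apply: (le_lt_trans _ Fi); apply: (@le_trans _ _ (mext (F i))).
      by apply: le_outer_measure; exact: subIsetr.
    by rewrite mextE.
  have BA0 : cm (B `\` (A `&` F i)) = 0.
    rewrite measureD//=; last 2 first.
    - exact: cara_measurable.
    - by rewrite /completed_measure_extension mextE// B1.
    rewrite (setIidr AB) /completed_measure_extension mextE// B1.
    by rewrite subee// ge0_fin_numE// outer_measure_ge0.
  have [|N [mN N0 BAN]] := @negligible_completed (B `\` (A `&` F i)).
    exists (B `\` (A `&` F i)); split => //.
    by apply: measurableD => //; exact: cara_measurable.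
  by exists (B, N); split.
have {reg}/choice[BN PBN] := reg.
exists (\bigcup_i (BN i).1), (\bigcup_i (BN i).2); split.
- by apply: bigcupT_measurable => i; case: (PBN i).
- by apply: bigcupT_measurable => i; case: (PBN i).
- apply: measure_negligible.
    by apply: bigcupT_measurable => i; case: (PBN i).
  by apply: (@negligible_bigcup _ _ _ m) => i; exists (BN i).2; case: (PBN i); split.
- move=> x Ax; have : setT x by [].
  by rewrite TF => -[i _ Fx]; exists i => //; case: (PBN i) => _ _ _ + _; exact.
- move=> x [[i _ Bx] Ax]; exists i => //.
  by case: (PBN i) => _ _ _ _; apply; split => // -[].
Qed.

(** Off the null set N the domains A and B coincide, so A may be replaced by B. The identity map
    from the completed space to the original one then carries the completed measure to m. *)
Lemma ge0_integral_completed A B N (f : T -> \bar R) :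
  mext.-cara.-measurable A -> measurable B -> measurable N -> m N = 0 ->
  A `+` B `<=` N -> measurable_fun setT f -> (forall x, 0 <= f x) ->
  \int[cm]_(x in A) f x = \int[m]_(x in B) f x.
Proof.
move=> mA mB mN N0 ABN mf f0.
have cN0 : cm N = 0 by rewrite /completed_measure_extension mextE.
have mcf : measurable_fun [set: caratheodory_type mext] f.
  by move=> _ Y mY; rewrite setTI; apply: cara_measurable;
    rewrite -[X in measurable X]setTI; exact: mf.
have mid : measurable_fun [set: caratheodory_type mext] (idfun : caratheodory_type mext -> T).
  by move=> _ Y mY; rewrite setTI; exact: cara_measurable.
transitivity (\int[cm]_(x in B) f x).
  rewrite (@ge0_negligible_integral _ (caratheodory_type mext) _ cm A N f)//; last 2 first.
  - exact: cara_measurable.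
  - exact: measurable_funTS.
  rewrite [RHS](@ge0_negligible_integral _ (caratheodory_type mext) _ cm B N f)//; last 3 first.
  - exact: cara_measurable.
  - exact: cara_measurable.
  - exact: measurable_funTS.
  congr (\int[_]_(_ in _) _); apply/seteqP; split => x [Ax Nx]; split => //.
    by apply: contrapT => Bx; apply/Nx/ABN; left.
  by apply: contrapT => Bx; apply/Nx/ABN; right.
rewrite -[LHS](@ge0_integral_pushforward _ _ (caratheodory_type mext) T _ _ mid cm B f)//.
- apply: eq_measure_integral => X mX _.
  exact: mextE.
- exact: measurable_funTS.
Qed.

End completion.

(** * Interactions by vertical slices *)

Section reflection.
Local Open Scope ereal_scope.
Context {R : realType}.
Notation Rm := (measurableTypeR R).
Notation lam := (@lebesgue_measure R).

(** The map h -> t - h preserves Lebesgue measure, being a reflection followed by a translation. *)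
Lemma ge0_integral_reflection (t : R) (g : measurableTypeR R -> \bar R) :
  measurable_fun setT g -> (forall u, 0 <= g u) ->
  \int[lam]_u g u = \int[lam]_h g (t - h)%R.
Proof.
move=> mg g0; pose f (h : measurableTypeR R) : measurableTypeR R := (t - h)%R.
have mf : measurable_fun setT f.
  by apply: measurable_funB => //; exact: measurable_id.
rewrite -[RHS](@ge0_integral_pushforward _ _ _ _ _ f mf lam setT g)//.
apply: eq_measure_integral => A mA _.
have mtA := measurable_vshift (- t)%R mA.
transitivity (lam (vshift (- t) A)); first by rewrite lebesgue_measure_vshift.
transitivity (pushforward lam (-%R : Rm -> Rm) (vshift (- t) A)).
  exact/esym/lebesgue_measureN.
congr (lam _); apply/seteqP; split => h;
  by rewrite /f /vshift /= opprK addrC.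
Qed.

End reflection.

Section slice.
Local Open Scope ereal_scope.
Context d (T : measurableType d) (R : realType).
Notation Rm := (measurableTypeR R).
Notation lam := (@lebesgue_measure R).
Implicit Types A B : set (T * Rm).

Definition slice A x : set Rm := [set t | A (x, t)].

Lemma measurable_slice A x : measurable A -> measurable (slice A x).
Proof.
move=> mA; rewrite -[slice A x]setTI.
exact: (pair1_measurable x measurableT mA).
Qed.

Lemma measurable_measure_slice A : measurable A ->
  measurable_fun setT (fun x => lam (slice A x)).
Proof.
move=> mA; rewrite (_ : (fun _ => _) = lam \o xsection A).
  exact: measurable_fun_xsection.
by apply/funext => x /=; rewrite xsectionE.
Qed.

End slice.

Section cross_section.
Local Open Scope ereal_scope.
Context d (T : measurableType d) (R : realType).
Notation Rm := (measurableTypeR R).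
Notation lam := (@lebesgue_measure R).
Implicit Types A B : set (T * Rm).

(** For z = (x, y, h), this is the cross-correlation at lag h of the indicators of the slices of A
    over x and of B over y. *)
Definition cross A B (z : T * T * Rm) : \bar R :=
  lam (slice A z.1.1 `&` vshift z.2 (slice B z.1.2)).

Lemma measurable_cross_set A B : measurable A -> measurable B ->
  measurable [set p : (T * T * Rm) * Rm |
    A (p.1.1.1, p.2) /\ B (p.1.1.2, (p.2 - p.1.2)%R)].
Proof.
move=> mA mB.
have m1 : measurable_fun setT (fun p : (T * T * Rm) * Rm => (p.1.1.1, p.2)).
  apply: measurable_fun_pair => //.
  by do 2 (apply: (measurableT_comp measurable_fst)).
have m2 : measurable_fun setT (fun p : (T * T * Rm) * Rm =>
    (p.1.1.2, (p.2 - p.1.2)%R : Rm)).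
  apply: measurable_fun_pair.
    apply: (measurableT_comp measurable_snd).
    by apply: (measurableT_comp measurable_fst).
  apply: measurable_funB => //.
  exact: (measurableT_comp measurable_snd).
by apply: measurableI; rewrite -[X in measurable X]setTI; [exact: m1|exact: m2].
Qed.

Lemma measurable_cross A B : measurable A -> measurable B ->
  measurable_fun setT (cross A B).
Proof.
move=> mA mB.
have := measurable_cross_set mA mB; set S := [set p | _] => mS.
have -> : cross A B = (fun z => lam (slice S z)) by [].
exact: (measurable_measure_slice mS).
Qed.

Lemma cross_ge0 A B z : 0 <= cross A B z.
Proof. exact: measure_ge0. Qed.

End cross_section.

Section interaction_slices.
Local Open Scope ereal_scope.
Context d (T : measurableType d) (R : realType)
  (mu : {sigma_finite_measure set T -> \bar R}).
Notation Rm := (measurableTypeR R).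
Notation lam := (@lebesgue_measure R).
Variable k : T * T * Rm -> \bar R.
Hypothesis mk : measurable_fun setT k.
Hypothesis k0 : forall z, 0 <= k z.
Implicit Types A B : set (T * Rm).

(** After the substitution tau = t - h the kernel no longer depends on t, so Tonelli leaves only a
    length as the integral in t. *)
Lemma integral_interaction_cross A B : measurable A -> measurable B ->
  \int[mu \x lam]_(X in A) \int[mu \x lam]_(Y in B)
     k (X.1, Y.1, (X.2 - Y.2)%R) =
  \int[mu]_x \int[mu]_y \int[lam]_h (k (x, y, h) * cross A B (x, y, h)).
Proof.
move=> mA mB.
pose phi (p : (T * Rm) * (T * Rm)) : \bar R :=
  (\1_(A `*` B) p)%:E * k (p.1.1, p.2.1, (p.1.2 - p.2.2)%R).
have phi0 p : 0 <= phi p by rewrite mule_ge0 // lee_fin.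
have mphi : measurable_fun setT phi.
  apply: emeasurable_funM.
    by apply/measurable_EFinP; apply: measurable_indic; exact: measurableX.
  apply: (measurableT_comp mk); apply: measurable_fun_pair.
    by apply: measurable_fun_pair; apply: (measurableT_comp measurable_fst).
  by apply: measurable_funB; apply: (measurableT_comp measurable_snd).
(* [S] and [psi] are the product of A and B and the function [phi] in the coordinates (X, y, h),
   where the second point is (y, t - h). *)
pose S : set ((T * Rm) * T * Rm) :=
  [set p | A p.1.1 /\ B (p.1.2, (p.1.1.2 - p.2)%R)].
have m12 : measurable_fun setT (fun p : (T * Rm) * T * Rm => p.1.1.2).
  apply: (measurableT_comp measurable_snd).
  exact: (measurableT_comp measurable_fst).
have mS : measurable S.
  apply: measurableI; rewrite -[X in measurable X]setTI.
    by apply: (measurableT_comp measurable_fst).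
  apply: (_ : measurable_fun setT (fun p : (T * Rm) * T * Rm =>
    (p.1.2, (p.1.1.2 - p.2)%R : Rm))) => //.
  apply: measurable_fun_pair; first exact: (measurableT_comp measurable_snd).
  exact: measurable_funB.
pose psi (p : (T * Rm) * T * Rm) : \bar R :=
  (\1_S p)%:E * k (p.1.1.1, p.1.2, p.2).
have psi0 p : 0 <= psi p by rewrite mule_ge0 // lee_fin.
have mpsi : measurable_fun setT psi.
  apply: emeasurable_funM.
    by apply/measurable_EFinP; exact: measurable_indic.
  apply: (measurableT_comp mk); apply: measurable_fun_pair => //.
  apply: measurable_fun_pair; last exact: (measurableT_comp measurable_snd).
  apply: (measurableT_comp measurable_fst).
  exact: (measurableT_comp measurable_fst).
have phipsi X y h : phi (X, (y, (X.2 - h)%R)) = psi (X, y, h).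
  rewrite /phi /psi !indicE/= subKr.
  suff -> : ((X, (y, (X.2 - h)%R)) \in A `*` B) = ((X, y, h) \in S) by [].
  by apply/idP/idP => /set_mem[XA YB]; apply/mem_set.
transitivity (\int[mu \x lam]_X \int[mu \x lam]_Y phi (X, Y)).
  rewrite integral_mkcond; apply: eq_integral => X _.
  rewrite patchE; case: ifPn => XA.
    rewrite integral_mkcond; apply: eq_integral => Y _.
    rewrite patchE /phi indicE in_setX XA/=.
    by case: ifPn => YB; rewrite ?mul1e ?mul0e.
  apply/esym; apply: integral0_eq => Y _.
  by rewrite /phi indicE in_setX (negbTE XA) mul0e.
transitivity (\int[mu \x lam]_X \int[mu]_y \int[lam]_h psi (X, y, h)).
  apply: eq_integral => X _.
  have mphiX : measurable_fun setT (fun Y => phi (X, Y)).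
    by apply: (measurableT_comp mphi); exact: pair1_measurable.
  rewrite (@fubini_tonelli1 _ _ _ _ _ mu lam _ mphiX (fun=> phi0 _)).
  apply: eq_integral => y _; rewrite /fubini_F.
  have mphiXy : measurable_fun setT (fun u : Rm => phi (X, (y, u))).
    by apply: (measurableT_comp mphiX); exact: pair1_measurable.
  rewrite (ge0_integral_reflection X.2 mphiXy (fun=> phi0 _)).
  by apply: eq_integral => h _; exact: phipsi.
have ipsi0 p : 0 <= \int[lam]_h psi (p, h) by exact: integral_ge0.
have iipsi0 X : 0 <= \int[mu]_y \int[lam]_h psi (X, y, h).
  by apply: integral_ge0 => y _; exact: ipsi0.
have mpsi1 := @measurable_fun_fubini_tonelli_F _ _ _ _ _ lam psi mpsi psi0.
have mpsi2 := @measurable_fun_fubini_tonelli_F _ _ _ _ _ mu _ mpsi1 ipsi0.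
rewrite (@fubini_tonelli1 _ _ _ _ _ mu lam _ mpsi2 iipsi0).
apply: eq_integral => x _; rewrite /fubini_F.
have mtyh : measurable_fun setT (fun p : Rm * T * Rm => psi (x, p.1.1, p.1.2, p.2)).
  apply: (measurableT_comp mpsi); apply: measurable_fun_pair => //.
  apply: measurable_fun_pair; last exact: (measurableT_comp measurable_snd).
  apply: measurable_fun_pair => //.
  exact: (measurableT_comp measurable_fst).
(* Two exchanges, of t with y and then of t with h, make t the innermost variable. *)
rewrite (@fubini_tonelli _ _ _ _ _ lam mu
  (fun p => \int[lam]_h psi (x, p.1, p.2, h)) _ (fun=> ipsi0 _)); last first.
  exact: (@measurable_fun_fubini_tonelli_F _ _ _ _ _ lam _ mtyh (fun=> psi0 _)).
apply: eq_integral => y _.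
rewrite (@fubini_tonelli _ _ _ _ _ lam lam
  (fun p => psi (x, p.1, y, p.2)) _ (fun=> psi0 _)); last first.
  apply: (measurableT_comp mpsi); apply: measurable_fun_pair => //.
  apply: measurable_fun_pair => //.
  exact: measurable_fun_pair.
apply: eq_integral => h _.
pose C := slice A x `&` vshift h (slice B y).
have mC : measurable C.
  apply: measurableI; first exact: measurable_slice.
  by apply: measurable_vshift; exact: measurable_slice.
transitivity (\int[lam]_t (k (x, y, h) * (\1_C t)%:E)).
  apply: eq_integral => t _; rewrite /psi !indicE muleC/=.
  suff -> : ((x, t, y, h) \in S) = (t \in C) by [].
  by apply/idP/idP => /set_mem ?; apply/mem_set.
rewrite ge0_integralZl//.
- by rewrite integral_indic// setIT.
- by apply/measurable_EFinP; exact: measurable_indic.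
Qed.

End interaction_slices.

Lemma measurable_setY d (T : measurableType d) (A B : set T) :
  measurable A -> measurable B -> measurable (A `+` B).
Proof. by move=> mA mB; apply: measurableU; exact: measurableD. Qed.

(** * The integrand of the perimeter over a pair of base points *)

Section slice_perimeter.
Local Open Scope ereal_scope.
Context {R : realType}.
Notation Rm := (measurableTypeR R).
Notation lam := (@lebesgue_measure R).
Implicit Types (P Q U V A B : set Rm).

Let lamDI A B : measurable A -> measurable B ->
  lam A = lam (A `\` B) + lam (A `&` B).
Proof. exact: measureDI. Qed.

(* [P] and [Q] are the slices of E over two points, [U] and [V] those of O. *)
Definition slice_per P U Q V (h : R) : \bar R :=
  lam ((P `&` U) `&` vshift h (~` Q `&` V)) +
  lam ((P `&` U) `&` vshift h (~` Q `\` V)) +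
  lam ((P `\` U) `&` vshift h (~` Q `&` V)).

(** The set on the left is cut according to whether t lies in U and whether t - h lies in V. Three
    of the four parts form [slice_per]; in the fourth both end points lie outside O. *)
Lemma slice_perD P U Q V h :
  measurable P -> measurable U -> measurable Q -> measurable V ->
  lam (P `\` vshift h Q) =
  slice_per P U Q V h + lam ((P `\` U) `&` vshift h (~` Q `\` V)).
Proof.
move=> mP mU mQ mV; set A := P `\` vshift h Q.
have mA : measurable A by apply: measurableD => //; exact: measurable_vshift.
have mVh := measurable_vshift h mV.
rewrite (lamDI mA mU) (lamDI (measurableD mA mU) mVh).
rewrite (lamDI (measurableI _ _ mA mU) mVh) /slice_per.
rewrite [RHS]addeAC -addeA addeC.
congr (_ + _); last first.
  rewrite addeC; congr (_ + _); congr (lam _); apply/seteqP;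
    split => t; rewrite /A /vshift /=; tauto.
congr (_ + _); congr (lam _); apply/seteqP;
  split => t; rewrite /A /vshift /=; tauto.
Qed.

Lemma eq_measureI_setY0 A A' B B' :
  measurable A -> measurable A' -> measurable B -> measurable B' ->
  lam (A `+` A') = 0 -> lam (B `+` B') = 0 ->
  lam (A `&` B) = lam (A' `&` B').
Proof.
move=> mA mA' mB mB' A0 B0; apply: eq_measure_setY0; [exact: measurableI..|].
apply: (@subset_measure0 _ _ _ lam _ ((A `+` A') `|` (B `+` B'))).
- by apply: measurable_setY; exact: measurableI.
- by apply: measurableU; exact: measurable_setY.
- move=> t; rewrite /=.
  by have [] := pselect (A t); have [] := pselect (A' t);
     have [] := pselect (B t); have [] := pselect (B' t); tauto.
- by apply: null_set_setU => //; exact: measurable_setY.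
Qed.

(** The second condition expresses that rearranging P moves mass only inside U. For empty U it says
    that P is a half-line up to a null set. *)
Definition almost_ray U P := raylike P /\ lam ((P `+` ray (height P)) `\` U) = 0.

(* [c] is the length of the part with both ends outside O, common to both
   configurations; it is finite, hence can be cancelled. *)
Lemma slice_per_ray P U Q V h : measurable U -> measurable V ->
  almost_ray U P -> almost_ray V Q ->
  let P' := ray (height P) in let Q' := ray (height Q) in
  exists2 c : R,
    lam (P `\` vshift h Q) = slice_per P U Q V h + c%:E &
    lam (P' `\` vshift h Q') = slice_per P' U Q' V h + c%:E.
Proof.
move=> mU mV [rP P0] [rQ Q0] P' Q'.
have [mP _ _ _] := rP; have [mQ _ _ _] := rQ.
have mP' : measurable P' := measurable_ray _.
have mQ' : measurable Q' := measurable_ray _.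
have rQh := raylike_vshift h rQ.
have [mQh _ _ _] := rQh.
pose C := lam ((P `\` U) `&` vshift h (~` Q `\` V)).
have mC : measurable ((P `\` U) `&` vshift h (~` Q `\` V)).
  apply: measurableI; first exact: measurableD.
  by apply: measurable_vshift; apply: measurableD => //; exact: measurableC.
have Cfin : C \is a fin_num.
  rewrite ge0_fin_numE ?measure_ge0//.
  have [_ _ + _] := raylike_commensurable rP rQh; apply: le_lt_trans.
  apply: le_measure; rewrite ?inE//; first exact: measurableD.
  by move=> t [[Pt _] [Qt _]].
have CE : C = lam ((P' `\` U) `&` vshift h (~` Q' `\` V)).
  apply: eq_measureI_setY0.
  - exact: measurableD.
  - exact: measurableD.
  - by apply: measurable_vshift; apply: measurableD => //; exact: measurableC.
  - by apply: measurable_vshift; apply: measurableD => //; exact: measurableC.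
  - rewrite -P0; congr (lam _); apply/seteqP; split => t /=; tauto.
  - rewrite -Q0 -[RHS](lebesgue_measure_vshift h); last first.
      by apply: measurableD => //; exact: measurable_setY.
    congr (lam _); apply/seteqP; split => t; rewrite /vshift/=.
      by have [] := pselect (Q (t - h)%R); have [] := pselect (Q' (t - h)%R); tauto.
    by have [] := pselect (Q (t - h)%R); have [] := pselect (Q' (t - h)%R); tauto.
exists (fine C); rewrite fineK//; first exact: slice_perD.
by rewrite CE; exact: slice_perD.
Qed.

(** Adding the common constant c turns both sides into measures of differences, to which
    [le_lebesgue_measure_rayD] applies, as translating Q by h adds h to its height. *)
Lemma le_slice_per P U Q V h : measurable U -> measurable V ->
  almost_ray U P -> almost_ray V Q ->
  slice_per (ray (height P)) U (ray (height Q)) V h <= slice_per P U Q V h.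
Proof.
move=> mU mV aP aQ; have [c PQ PQ'] := slice_per_ray h mU mV aP aQ.
rewrite -(@leeD2rE _ c%:E)// -PQ -PQ'.
have [rP _] := aP; have [rQ _] := aQ.
have rQh := raylike_vshift h rQ.
rewrite vshift_ray -height_vshift//.
exact: le_lebesgue_measure_rayD.
Qed.

Lemma slice_per_ray_fin P U Q V h : measurable U -> measurable V ->
  almost_ray U P -> almost_ray V Q ->
  slice_per (ray (height P)) U (ray (height Q)) V h \is a fin_num.
Proof.
move=> mU mV aP aQ; have [c _ PQ'] := slice_per_ray h mU mV aP aQ.
have : lam (ray (height P) `\` vshift h (ray (height Q))) \is a fin_num.
  by rewrite vshift_ray lebesgue_measure_rayD.
by rewrite PQ' fin_numD => /andP[].
Qed.

Lemma lt_slice_per P U Q : measurable U -> almost_ray U P ->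
  almost_ray set0 Q -> lam (P `+` ray (height P)) != 0 ->
  exists2 I : set Rm, measurable I /\ lam I != 0 & forall h, I h ->
  slice_per (ray (height P)) U (ray (height Q)) set0 h <
  slice_per P U Q set0 h.
Proof.
move=> mU aP aQ P0; have [rP _] := aP; have [rQ Q0] := aQ.
have [e e0 He] := lt_lebesgue_measure_rayD rP P0.
(* These are the h for which the end point [height Q + h] lies strictly between [height P - e] and
   [height P]. *)
exists `](height P - e - height Q)%R, (height P - height Q)%R[%classic.
  split; first exact: measurable_itv.
  rewrite lebesgue_measure_itv/= lte_fin ltrD2r ltrBlDr ltrDl e0.
  by rewrite -EFinB eqe; apply/eqP; lra.
move=> h /=; rewrite in_itv/= => hI.
have [c PQ PQ'] := slice_per_ray h mU measurable0 aP aQ.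
rewrite -(@lteD2rE _ c%:E)// -PQ -PQ'.
have [mP _ _ _] := rP; have [mQ _ _ _] := rQ.
(* Over an empty V, Q is almost a half-line and can be replaced by its ray. *)
have -> : lam (P `\` vshift h Q) = lam (P `\` ray (height Q + h)).
  apply: eq_measureI_setY0 => //.
  - by apply: measurableC; exact: measurable_vshift.
  - exact: measurableC.
  - by rewrite setYK.
  - rewrite -Q0 -vshift_ray setD0 -[RHS](lebesgue_measure_vshift h); last first.
      exact: measurable_setY.
    congr (lam _); apply/seteqP; split => t; rewrite /vshift/=.
      by have [] := pselect (Q (t - h)%R);
         have [] := pselect (ray (height Q) (t - h)%R); tauto.
    by have [] := pselect (Q (t - h)%R);
       have [] := pselect (ray (height Q) (t - h)%R); tauto.
by rewrite vshift_ray; apply: He; lra.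
Qed.

End slice_perimeter.

(** * Null sets and vanishing integrals *)

Section integral_zero.
Local Open Scope ereal_scope.
Context d (T : measurableType d) (R : realType).
Variable m : {measure set T -> \bar R}.

Lemma measure_setD_null (A N : set T) : measurable A -> measurable N ->
  m N = 0 -> m (A `\` N) = m A.
Proof.
move=> mA mN N0; apply: eq_measure_setY0 => //; first exact: measurableD.
apply: (@subset_measure0 _ _ _ m _ N) => //.
  by apply: measurable_setY => //; exact: measurableD.
by move=> x /= [[[]//]|[Ax]]; have [] := pselect (N x); tauto.
Qed.

(** The points where f does not vanish form a negligible set, which cannot contain Z. The lemma
    serves to pick points when an iterated integral is zero. *)
Lemma ge0_integral0_exists (f : T -> \bar R) (Z : set T) :
  measurable_fun setT f -> (forall x, 0 <= f x) -> \int[m]_x f x = 0 ->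
  measurable Z -> m Z != 0 -> exists2 x, Z x & f x = 0.
Proof.
move=> mf f0 If0 mZ Z0; apply: contrapT => nex.
have : \int[m]_x `|f x| = 0.
  by rewrite -[RHS]If0; apply: eq_integral => x _; rewrite gee0_abs.
move/(ae_eq_integral_abs _ measurableT mf) => [N [mN N0 fN]].
move/eqP : Z0; apply; apply: (subset_measure0 mZ mN _ N0) => x Zx.
by apply: fN => /= /(_ Logic.I) fx0; apply: nex; exists x.
Qed.

Lemma ge0_eq_integral_negligible (f g : T -> \bar R) (G : set T) :
  measurable_fun setT f -> measurable_fun setT g ->
  (forall x, 0 <= f x) -> (forall x, 0 <= g x) -> m.-negligible (~` G) ->
  (forall x, G x -> f x = g x) -> \int[m]_x f x = \int[m]_x g x.
Proof.
move=> mf mg f0 g0 nG fg; apply: ge0_ae_eq_integral => //.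
by apply: negligibleS nG => x /= fgx Gx; apply: fgx => _; exact: fg.
Qed.

End integral_zero.

(** * Rearrangement of a Borel set *)

Section borel_rearrangement.
Local Open Scope ereal_scope.
Context d (T : measurableType d) (R : realType)
  (mu : {sigma_finite_measure set T -> \bar R}).
Notation Rm := (measurableTypeR R).
Notation lam := (@lebesgue_measure R).
Variable k : T * T * Rm -> \bar R.
Hypothesis mk : measurable_fun setT k.
Hypothesis k0 : forall z, 0 <= k z.
Implicit Types E O A B : set (T * Rm).

Definition kernel_interaction A B :=
  \int[mu \x lam]_(X in A) \int[mu \x lam]_(Y in B)
     k (X.1, Y.1, (X.2 - Y.2)%R).

Definition kernel_perimeter E O := kernel_interaction (E `&` O) (~` E `&` O) +
  kernel_interaction (E `&` O) (~` E `\` O) +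
  kernel_interaction (E `\` O) (~` E `&` O).

Definition section_per E O (z : T * T * Rm) :=
  slice_per (slice E z.1.1) (slice O z.1.1) (slice E z.1.2) (slice O z.1.2) z.2.

Lemma section_perE E O z : section_per E O z =
  cross (E `&` O) (~` E `&` O) z + cross (E `&` O) (~` E `\` O) z +
  cross (E `\` O) (~` E `&` O) z.
Proof. by []. Qed.

Lemma section_per_ge0 E O z : 0 <= section_per E O z.
Proof. by rewrite section_perE !adde_ge0 ?cross_ge0. Qed.

Lemma measurable_section_per E O : measurable E -> measurable O ->
  measurable_fun setT (section_per E O).
Proof.
move=> mE mO; have mCE := measurableC mE.
rewrite (funext (section_perE E O)).
apply: emeasurable_funD; first apply: emeasurable_funD.
all: by apply: measurable_cross; (exact: measurableI || exact: measurableD).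
Qed.

Definition weighted_integral (F : T * T * Rm -> \bar R) :=
  \int[mu]_x \int[mu]_y \int[lam]_h (k (x, y, h) * F (x, y, h)).

Section weighted.
Variable F : T * T * Rm -> \bar R.
Hypothesis mF : measurable_fun setT F.
Hypothesis F0 : forall z, 0 <= F z.

Let kF0 z : 0 <= k z * F z. Proof. exact: mule_ge0. Qed.

Lemma measurable_weighted1 :
  measurable_fun setT (fun p : T * T => \int[lam]_h (k (p, h) * F (p, h))).
Proof.
apply: (@measurable_fun_fubini_tonelli_F _ _ _ _ _ lam (fun z => k z * F z)) => //.
exact: emeasurable_funM.
Qed.

Lemma weighted1_ge0 p : 0 <= \int[lam]_h (k (p, h) * F (p, h)).
Proof. exact: integral_ge0. Qed.

Lemma measurable_weighted2 : measurable_fun setT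
  (fun x : T => \int[mu]_y \int[lam]_h (k (x, y, h) * F (x, y, h))).
Proof.
exact: (@measurable_fun_fubini_tonelli_F _ _ _ _ _ mu _ measurable_weighted1
  weighted1_ge0).
Qed.

Lemma weighted2_ge0 x : 0 <= \int[mu]_y \int[lam]_h (k (x, y, h) * F (x, y, h)).
Proof. by apply: integral_ge0 => y _; exact: weighted1_ge0. Qed.

Lemma weighted_integral_ge0 : 0 <= weighted_integral F.
Proof. by apply: integral_ge0 => x _; exact: weighted2_ge0. Qed.

Lemma measurable_weighted0 x y : measurable_fun setT (fun h => k (x, y, h) * F (x, y, h)).
Proof.
apply: (@measurableT_comp _ _ _ _ _ _ (fun z => k z * F z)).
  exact: emeasurable_funM.
exact: pair1_measurable.
Qed.

Lemma measurable_weighted1x x :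
  measurable_fun setT (fun y => \int[lam]_h (k (x, y, h) * F (x, y, h))).
Proof.
apply: (measurableT_comp measurable_weighted1); exact: pair1_measurable.
Qed.

End weighted.

Lemma weighted_integralD F G : measurable_fun setT F -> measurable_fun setT G ->
  (forall z, 0 <= F z) -> (forall z, 0 <= G z) ->
  weighted_integral (F \+ G) = weighted_integral F + weighted_integral G.
Proof.
move=> mF mG F0 G0; rewrite -ge0_integralD//; last 4 first.
- by move=> x _; exact: weighted2_ge0.
- exact: measurable_weighted2.
- by move=> x _; exact: weighted2_ge0.
- exact: measurable_weighted2.
apply: eq_integral => x _; rewrite -ge0_integralD//; last 4 first.
- by move=> y _; exact: weighted1_ge0.
- exact: measurable_weighted1x.
- by move=> y _; exact: weighted1_ge0.
- exact: measurable_weighted1x.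
apply: eq_integral => y _; rewrite -ge0_integralD//; last 4 first.
- by move=> h _; exact: mule_ge0.
- exact: measurable_weighted0.
- by move=> h _; exact: mule_ge0.
- exact: measurable_weighted0.
by apply: eq_integral => h _; rewrite ge0_muleDr.
Qed.

Lemma eq_weighted_integral F G (H : set T) :
  measurable_fun setT F -> measurable_fun setT G ->
  (forall z, 0 <= F z) -> (forall z, 0 <= G z) ->
  mu.-negligible (~` H) ->
  (forall x y h, H x -> H y -> F (x, y, h) = G (x, y, h)) ->
  weighted_integral F = weighted_integral G.
Proof.
move=> mF mG F0 G0 nH FG; apply: (ge0_eq_integral_negligible _ _ _ _ nH).
- exact: measurable_weighted2.
- exact: measurable_weighted2.
- exact: weighted2_ge0.
- exact: weighted2_ge0.
move=> x Hx; apply: (ge0_eq_integral_negligible _ _ _ _ nH).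
- exact: measurable_weighted1x.
- exact: measurable_weighted1x.
- by move=> y; exact: weighted1_ge0.
- by move=> y; exact: weighted1_ge0.
by move=> y Hy; apply: eq_integral => h _; rewrite FG.
Qed.

Lemma kernel_perimeterE E O : measurable E -> measurable O ->
  kernel_perimeter E O = weighted_integral (section_per E O).
Proof.
move=> mE mO; have mCE := measurableC mE.
have mEO := measurableI _ _ mE mO; have mCEO := measurableI _ _ mCE mO.
have mDO := measurableD mE mO; have mCDO := measurableD mCE mO.
rewrite /kernel_perimeter /kernel_interaction !integral_interaction_cross//.
rewrite -weighted_integralD; first rewrite -weighted_integralD//.
all: try by move=> z; rewrite ?adde_ge0 ?cross_ge0.
all: try exact: measurable_cross.
by apply: emeasurable_funD; exact: measurable_cross.
Qed.

Section rearrangement.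
Variables E O : set (T * Rm).
Hypotheses (mE : measurable E) (mO : measurable O).

Definition slice_height x := height (slice E x).
Definition rearrangement : set (T * Rm) := [set X | (X.2 < slice_height X.1)%R].
Let Es := rearrangement.

Lemma slice_rearrangement x : slice Es x = ray (slice_height x).
Proof. by apply/seteqP; split => t; rewrite /slice /Es /ray/= in_itv/=. Qed.

Lemma measurable_slice_height : measurable_fun setT slice_height.
Proof.
have mr0 : measurable (setT `*` ray 0%R : set (T * Rm)).
  by apply: measurableX => //; exact: measurable_ray.
apply: measurable_funB.
  apply: (measurableT_comp (@fine_measurable R setT measurableT)).
  rewrite [X in measurable_fun _ X](_ : _ =
      (fun x => lam (slice (E `\` (setT `*` ray 0%R)) x))).
    by apply: measurable_measure_slice; exact: measurableD.
  apply/funext => x /=; congr (lam _).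
  by apply/seteqP; split => t; rewrite /slice/=; tauto.
apply: (measurableT_comp (@fine_measurable R setT measurableT)).
rewrite [X in measurable_fun _ X](_ : _ =
    (fun x => lam (slice ((setT `*` ray 0%R) `\` E) x))).
  by apply: measurable_measure_slice; exact: measurableD.
apply/funext => x /=; congr (lam _).
by apply/seteqP; split => t; rewrite /slice/=; tauto.
Qed.

Lemma measurable_rearrangement : measurable Es.
Proof.
have : measurable_fun [set: T * Rm] (fun X => (X.2 : R) < slice_height X.1)%R.
  apply: measurable_fun_ltr => //.
  exact: (measurableT_comp measurable_slice_height).
by move=> /(_ measurableT [set true]); rewrite setTI; apply.
Qed.

Hypothesis good_ae :
  mu.-negligible (~` [set x | almost_ray (slice O x) (slice E x)]).

Let M := section_per E O.
Let Ms := section_per Es O.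
Let mM : measurable_fun setT M. Proof. exact: measurable_section_per. Qed.
Let mMs : measurable_fun setT Ms.
Proof. exact: measurable_section_per measurable_rearrangement mO. Qed.
(** The cut-off at 0 makes the deficit nonnegative everywhere. Over pairs of good base points M - Ms
    is already nonnegative, and Ms is finite there. *)
Let delta : T * T * Rm -> \bar R := fun z => maxe (M z - Ms z) 0.
Let mdelta : measurable_fun setT delta.
Proof. by apply: measurable_maxe => //; exact: emeasurable_funB. Qed.
Let delta0 z : 0 <= delta z.
Proof. by rewrite /delta le_max lexx orbT. Qed.

Let MsE x y h : Ms (x, y, h) = slice_per (ray (slice_height x)) (slice O x)
  (ray (slice_height y)) (slice O y) h.
Proof. by rewrite /Ms /section_per /= !slice_rearrangement. Qed.

(** The deficit is kept as an explicit integral: its sign gives the inequality, and its vanishing is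
    the starting point of the equality case. *)
Lemma kernel_perimeter_deficit :
  kernel_perimeter E O = kernel_perimeter Es O + weighted_integral delta.
Proof.
rewrite !kernel_perimeterE//; last exact: measurable_rearrangement.
rewrite -(weighted_integralD mMs mdelta (@section_per_ge0 Es O) delta0).
have Ms0 z : 0 <= Ms z by exact: section_per_ge0.
apply: (eq_weighted_integral _ _ _ _ good_ae) => //.
- exact: emeasurable_funD.
- exact: section_per_ge0.
- by move=> z; exact: adde_ge0.
move=> x y h ax ay; have mOx := measurable_slice x mO.
have mOy := measurable_slice y mO.
have := le_slice_per h mOx mOy ax ay.
have := slice_per_ray_fin h mOx mOy ax ay.
rewrite -MsE => Mfin MsM.
rewrite /= /delta; have /max_idPl -> : 0 <= M (x, y, h) - Ms (x, y, h).
  by rewrite sube_ge0 // Mfin.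
by rewrite addeC subeK.
Qed.

Lemma kernel_perimeter_rearrangement_le :
  kernel_perimeter Es O <= kernel_perimeter E O.
Proof. by rewrite kernel_perimeter_deficit leeDl// weighted_integral_ge0. Qed.

(** If the perimeters were equal, finiteness would allow cancelling them, and the integral of
    [delta] would vanish. Then one may pick x whose slice is not almost a ray, y in Y and h in the
    interval of [lt_slice_per] with k * delta = 0 at (x, y, h), although both factors are positive
    there. *)
Lemma kernel_perimeter_rearrangement_lt (Y : set T) :
  (forall x y h, x <> y -> 0 < k (x, y, h)) ->
  measurable Y -> mu Y != 0 -> (forall y, Y y -> slice O y = set0) ->
  (mu \x lam) (E `+` Es) != 0 ->
  kernel_perimeter E O < +oo ->
  kernel_perimeter Es O < kernel_perimeter E O.
Proof.
move=> kgt0 mY Y0 YO E0 Pfin; rewrite lt_neqAle kernel_perimeter_rearrangement_le.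
rewrite andbT; apply/eqP => PE.
have mEs := measurable_rearrangement.
have mEY := measurable_setY mE mEs.
have D0 : weighted_integral delta = 0.
  have Psfin : kernel_perimeter Es O \is a fin_num.
    rewrite PE ge0_fin_numE// kernel_perimeterE//.
    by apply: weighted_integral_ge0; exact: section_per_ge0.
  by rewrite -(addeK (weighted_integral delta) Psfin) [_ + kernel_perimeter Es O]addeC
    -kernel_perimeter_deficit -PE subee.
have [N [mN N0 goodN]] := good_ae.
have good x : ~ N x -> almost_ray (slice O x) (slice E x).
  by move=> Nx; apply: contrapT => /goodN.
have setDN0 X : measurable X -> mu X != 0 -> mu (X `\` N) != 0.
  by move=> mX; rewrite measure_setD_null.
(* [Z] consists of the base points whose slice is not almost its ray. By Tonelli it has positive
   measure, since E and its rearrangement differ on a set of positive measure. *)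
pose Z := [set x | lam (slice (E `+` Es) x) != 0].
have mZ : measurable Z.
  rewrite -[Z]setTI; apply: emeasurable_neq => //.
  exact: measurable_measure_slice.
have Z0 : mu Z != 0.
  apply: contra E0 => /eqP Z0; apply/eqP.
  rewrite /product_measure1/= -[RHS](integral0 mu setT).
  apply: (@ge0_eq_integral_negligible _ _ _ mu _ _ (~` Z)).
  - exact: measurable_fun_xsection.
  - exact: measurable_cst.
  - by move=> x; exact: measure_ge0.
  - by [].
  - by rewrite setCK; apply/negligibleP.
  - by move=> x /negP/negPn/eqP; rewrite /= xsectionE.
have [x [Zx /good ax] Dx] := ge0_integral0_exists (measurable_weighted2 mdelta delta0)
  (weighted2_ge0 delta0) D0 (measurableD mZ mN) (setDN0 _ mZ Z0).
have [y [Yy /good ay] Dxy] := ge0_integral0_exists (measurable_weighted1x mdelta delta0 x)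
  (fun y => weighted1_ge0 delta0 (x, y)) Dx (measurableD mY mN) (setDN0 _ mY Y0).
have Zx' : lam (slice E x `+` ray (slice_height x)) != 0.
  by rewrite -slice_rearrangement.
have mOx := measurable_slice x mO.
move: ay; rewrite (YO y Yy) => ay.
have [I [mI I0] HI] := lt_slice_per mOx ax ay Zx'.
have [h Ih /eqP] := ge0_integral0_exists (measurable_weighted0 mdelta x y)
  (fun h => mule_ge0 (k0 _) (delta0 _)) Dxy mI I0.
rewrite mule_eq0 => /orP[/eqP kxyh|].
  (* If x were y, then O would be empty over x and the slice of E over x would be almost a ray,
     against the choice of x in [Z]. *)
  have xy : x <> y.
    move=> xy; move: Zx'; case: ax => _ /=.
    by rewrite xy (YO y Yy) setD0 => ->; rewrite eqxx.
  by have := kgt0 x y h xy; rewrite kxyh ltxx.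
have := HI h Ih; rewrite /delta.
have -> : M (x, y, h) = slice_per (slice E x) (slice O x) (slice E y) set0 h.
  by rewrite -(YO y Yy).
have -> : Ms (x, y, h) = slice_per (ray (slice_height x)) (slice O x)
    (ray (slice_height y)) set0 h by rewrite MsE (YO y Yy).
rewrite -sube_gt0 => Hlt; have /max_idPl -> := ltW Hlt.
by rewrite gt_eqF.
Qed.

End rearrangement.
End borel_rearrangement.

(** * The kernel and the measure on R^n *)

Section euclidean_space.
Context {R : realType} {n : nat}.
Notation Rm := (measurableTypeR R).
Notation lam := (@lebesgue_measure R).
Notation muV := (lebesgue_measure_rV R n).
Implicit Types Omega : set 'rV[R]_n.

(** The sigma-algebra is generated by the coordinates, so an open set is written as the countable
    union of the boxes with rational centre and half-side 1/(k+1) that it contains. *)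
Lemma open_measurable_rV Omega : open Omega -> measurable Omega.
Proof.
move=> oO.
pose side (p : 'rV[rat]_n * nat) i : set Rm :=
  `](ratr (p.1 ord0 i) - p.2.+1%:R^-1), (ratr (p.1 ord0 i) + p.2.+1%:R^-1)[%classic.
pose box p : set 'rV[R]_n := [set y | forall i, side p i (y ord0 i)].
have mbox p : measurable (box p).
  by apply: (measurable_rV_box (A := side p)) => i; exact: measurable_itv.
rewrite (_ : Omega = \bigcup_p [set y | box p `<=` Omega /\ box p y]).
  apply: countable_bigcupT_measurable => // p.
  have [bO|nbO] := pselect (box p `<=` Omega).
    by rewrite (_ : [set y | _] = box p)//; apply/seteqP; split => [y []|].
  by rewrite (_ : [set y | _] = set0)//; apply/seteqP; split => [y []|].
apply/seteqP; split => [x Ox|x [p _ [bO]]]; last exact: bO.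
have /nbhs_ballP[e /= e0 xeO] : nbhs x Omega by exact: open_nbhs_nbhs.
have e20 : 0 < e / 2 by rewrite divr_gt0.
(* With d < e/2, a box of half-side d whose centre is within d of x, coordinate by coordinate, stays
   in the ball of radius e about x. *)
have [k] := ltr_add_invr e20; rewrite add0r => ke; set d := k.+1%:R^-1 in ke.
have d0 : 0 < d by rewrite invr_gt0.
have qi i : exists q : rat, x ord0 i - d < ratr q < x ord0 i + d.
  have [|q] := @rat_in_itvoo R (x ord0 i - d) (x ord0 i + d); first by lra.
  by rewrite in_itv/=; exists q.
have /choice[q Hq] := qi.
exists (\row_i q i, k) => //; split; last first.
  by move=> i; rewrite /side/= mxE in_itv/= -/d; have := Hq i; lra.
move=> y yb; apply: xeO; split => // i j; rewrite (ord1 i).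
have := yb j; rewrite /side/= mxE in_itv/= -/d => yj.
by rewrite /ball/= ltr_norml; have := Hq j; lra.
Qed.

(** The witness is a cube of volume 1 with all coordinates above C + 1, a bound for the sup norm on
    Omega. Having at least one coordinate makes it disjoint from Omega. *)
Lemma bounded_set_rV_disjoint Omega : (0 < n)%N -> bounded_set Omega ->
  exists Y : set 'rV[R]_n,
    [/\ measurable Y, muV Y != 0%E & forall y, Y y -> ~ Omega y].
Proof.
move=> n0 [C [_ HC]].
pose side (i : 'I_n) : set Rm := `](C + 1), (C + 2)[%classic.
have mside i : measurable (side i) by exact: measurable_itv.
exists [set x | forall i, side i (x ord0 i)]; split.
- exact: (measurable_rV_box mside).
- rewrite (lebesgue_measure_rV_box mside).
  rewrite big1 ?onee_neq0// => i _; rewrite lebesgue_measure_itv/= lte_fin.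
  by rewrite ifT; [rewrite -EFinB; congr EFin|]; lra.
- move=> y Yy Oy; have /= := HC (C + 1) _ _ Oy; rewrite ltrDl ltr01 => /(_ isT).
  apply/negP; rewrite -ltNge; have := Yy (Ordinal n0); rewrite /side/= in_itv/=.
  move=> /andP[Cy _]; apply: (lt_le_trans Cy).
  rewrite (le_trans (ler_norm _))//.
  rewrite /Num.norm/= mx_normrE.
  by apply: (le_bigmax _ (fun i => `|y i.1 i.2|) (ord0, Ordinal n0)).
Qed.

End euclidean_space.

Section riesz_kernel.
Context {R : realType} {n : nat}.
Notation Rm := (measurableTypeR R).
Variable s : R.

(* |X - Y|^-(n + 1 + s) for X = (x, t) and Y = (y, t - h), at z = (x, y, h). *)
Definition riesz_kernel (z : 'rV[R]_n * 'rV[R]_n * Rm) : \bar R :=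
  ((Num.sqrt (\sum_(i < n) (z.1.1 ord0 i - z.1.2 ord0 i) ^+ 2 + z.2 ^+ 2) `^
    (n%:R + 1 + s))^-1)%:E.

Lemma riesz_kernel_ge0 z : (0 <= riesz_kernel z)%E.
Proof. by rewrite lee_fin invr_ge0 powR_ge0. Qed.

(** Distinct base points keep the distance positive for every h, including h = 0. *)
Lemma riesz_kernel_gt0 x y h : x <> y -> (0 < riesz_kernel (x, y, h))%E.
Proof.
move=> xy; rewrite lte_fin invr_gt0 powR_gt0// sqrtr_gt0/=.
have sq0 (i : 'I_n) : 0 <= (x ord0 i - y ord0 i) ^+ 2 by exact: sqr_ge0.
have [i xyi] : exists i, x ord0 i != y ord0 i.
  apply: contra_notP xy => nex; apply/rowP => i; apply/eqP.
  by apply: contra_notT nex => xyi; exists i.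
rewrite (bigD1 i)//= -addrA ltr_pwDl//.
  by rewrite lt0r sq0 sqrf_eq0 subr_eq0 xyi.
by rewrite addr_ge0 ?sqr_ge0// sumr_ge0.
Qed.

Lemma measurable_riesz_kernel : measurable_fun setT riesz_kernel.
Proof.
apply/measurable_EFinP.
rewrite (_ : (fun _ => _) = (fun z : 'rV[R]_n * 'rV[R]_n * Rm =>
  (Num.sqrt (\sum_(i < n) (z.1.1 ord0 i - z.1.2 ord0 i) ^+ 2 + z.2 ^+ 2) `^
    (- (n%:R + 1 + s))))); last by apply/funext => z; rewrite powRN.
apply: (measurableT_comp (measurable_powR _)).
apply: (measurableT_comp (continuous_measurable_fun (@sqrt_continuous R))).
apply: measurable_funD; last exact: measurable_funX.
apply: measurable_sum => i; apply: measurable_funX.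
apply: measurable_funB; apply: (measurableT_comp (measurable_coor i)).
  exact: (measurableT_comp measurable_fst).
exact: (measurableT_comp measurable_snd).
Qed.

End riesz_kernel.

(** * Lebesgue measurable sets *)

Section completed_sections.
Local Open Scope ereal_scope.
Context {R : realType}.
Notation Rm := (measurableTypeR R).
Notation lam := (@lebesgue_measure R).
Notation clam := (@completed_lebesgue_measure R).
Variables (A A' D : set Rm) (a b : R).
Hypotheses (mA' : measurable A') (mD : measurable D) (D0 : lam D = 0).
Hypotheses (AA' : A `<=` A') (A'D : A' `\` A `<=` D).
Hypotheses (aA : ray a `<=` A) (Ab : A `<=` ray b).

Lemma ray_sub_superset : ray a `<=` A'.
Proof. exact: subset_trans AA'. Qed.

Lemma superset_setD_ray : lam (A' `\` ray b) = 0.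
Proof.
apply: (@subset_measure0 _ _ _ lam _ D) => //.
  by apply: measurableD => //; exact: measurable_ray.
by move=> t [A't bt]; apply: A'D; split => // /Ab.
Qed.

Lemma commensurable_superset : commensurable lam A' (ray a).
Proof.
split => //; last first.
  rewrite (_ : _ `\` _ = set0) ?measure0//.
  by apply/seteqP; split => // t [/ray_sub_superset].
have : lam (A' `\` ray a) <= lam (A' `\` ray b) + lam (ray b `\` ray a).
  apply: le_trans (measureU2 _ _ _); try exact: measurableD.
  apply: le_measure; rewrite ?inE//; first exact: measurableD.
    by apply: measurableU; exact: measurableD.
  by move=> t [A't at_]; have [bt|bt] := pselect (ray b t); [right|left].
move=> /le_lt_trans; apply.
by rewrite superset_setD_ray add0e lebesgue_measure_rayD ltry.
Qed.

Lemma raylike_superset : raylike A'.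
Proof.
exact: commensurable_trans commensurable_superset (commensurable_ray a 0%R).
Qed.

Lemma height_superset_ge : (a <= height A')%R.
Proof.
rewrite -subr_ge0 -[X in (_ - X)%R](height_ray a).
rewrite -(excess_raylike raylike_superset (raylike_ray a)) /excess/=.
rewrite (_ : ray a `\` A' = set0) ?measure0 ?subr0 ?fine_ge0//.
by apply/seteqP; split => // t [/ray_sub_superset].
Qed.

Lemma height_superset_le : (height A' <= b)%R.
Proof.
rewrite -subr_le0 -[X in (_ - X)%R](height_ray b).
rewrite -(excess_raylike raylike_superset (raylike_ray b)) /excess/=.
by rewrite superset_setD_ray/= sub0r oppr_le0 fine_ge0.
Qed.

Let cara (B : set Rm) : measurable B ->
  measurable (B : set (caratheodory_type (@wlength R idfun)^*%mu)).
Proof. exact: sub_caratheodory. Qed.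

Let nullC (B : set Rm) : B `<=` D -> clam.-negligible B.
Proof. by exists D; split => //; exact: cara. Qed.

Let cA : measurable (A : set (caratheodory_type (@wlength R idfun)^*%mu)).
Proof.
rewrite -(setIidr AA') -setDD; apply: measurableD; first exact: cara.
by apply: completed_lebesgue_measure_is_complete; exact: nullC.
Qed.

Lemma integral_completed_indic (r : R) :
  \int[clam]_(t in `[(- r)%R, r]) (\1_A t)%:E = lam (A' `&` `[(- r)%R, r]).
Proof.
have cI : measurable
    (`[(- r)%R, r]%classic : set (caratheodory_type (@wlength R idfun)^*%mu)).
  by apply: cara; exact: measurable_itv.
rewrite integral_indic//.
have -> : lam (A' `&` `[(- r)%R, r]) = clam (A' `&` `[(- r)%R, r]) by [].
apply: eq_measure_setY0; [exact: measurableI|by apply: measurableI => //; exact: cara|].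
apply: measure_negligible.
  by apply: measurable_setY; apply: measurableI => //; exact: cara.
apply: nullC => t /= [[[/AA' A't It] nA't]|[[A't It] nAt]]; first by case: nA't.
by apply: A'D; split => // At; apply: nAt.
Qed.

(** As soon as -r <= a and b <= r, the integral is the measure of A' \ [ray (- r)], that is,
    [height A'] + r; the expression is therefore eventually constant. *)
Lemma lim_height :
  (lim ((\int[clam]_(t in `[- r, r]) \1_A t) - r @[r --> +oo]) = height A')%R.
Proof.
apply: lim_near_cst => //; near=> r.
have ra : (- r <= a)%R by rewrite lerNl; near: r; apply: nbhs_pinfty_ge; rewrite num_real.
have rb : (b <= r)%R by near: r; apply: nbhs_pinfty_ge; rewrite num_real.
rewrite /Rintegral integral_completed_indic.
have := excess_raylike raylike_superset (raylike_ray (- r)).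
rewrite height_ray opprK => hE; apply/eqP; rewrite subr_eq -hE; apply/eqP.
rewrite /excess/=.
rewrite (_ : ray (- r)%R `\` A' = set0); last first.
  apply/seteqP; split => // t [rt]; apply; apply: ray_sub_superset.
  by move: rt; rewrite /ray/= !in_itv/= => /lt_le_trans; apply.
rewrite measure0 subr0; congr fine; apply: eq_measure_setY0.
- by apply: measurableI => //; exact: measurable_itv.
- by apply: measurableD => //; exact: measurable_ray.
have mI : measurable (A' `&` `[(- r)%R, r]).
  by apply: measurableI => //; exact: measurable_itv.
have mrA : measurable (A' `\` ray (- r)%R) by apply: measurableD.
apply: (@subset_measure0 _ _ _ lam _ (A' `\` ray b)).
- exact: measurable_setY.
- by apply: measurableD => //; exact: measurable_ray.
- move=> t; rewrite /ray/= !in_itv/= => -[[[A't /andP[rt tr]]]|[[A't /negP]]].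
    by move=> /not_andP[//|/contrapT]; rewrite ltNge rt.
  rewrite -leNgt => rt /not_andP[//|/negP]; rewrite rt/= -ltNge => tr.
  by split => //; apply/negP; rewrite -leNgt (le_trans rb)// ltW.
- exact: superset_setD_ray.
Unshelve. all: by end_near. Qed.

End completed_sections.

(** * Null sets in the product and in its completion *)

Section product_null.
Local Open Scope ereal_scope.
Context d (T : measurableType d) (R : realType)
  (mu : {sigma_finite_measure set T -> \bar R}).
Notation Rm := (measurableTypeR R).
Notation lam := (@lebesgue_measure R).

Lemma product_null_slice (N : set (T * Rm)) : measurable N ->
  (mu \x lam) N = 0 -> mu.-negligible (~` [set x | lam (slice N x) = 0]).
Proof.
move=> mN N0; pose f x := lam (xsection N x).
have mf : measurable_fun setT f by exact: measurable_fun_xsection.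
have : \int[mu]_x `|f x| = 0.
  by rewrite -[RHS]N0; apply: eq_integral => x _; rewrite gee0_abs.
move/(ae_eq_integral_abs _ measurableT mf); apply: negligibleS => x /= fx0 H.
by apply: fx0; rewrite -(H Logic.I) /f xsectionE.
Qed.

Lemma product_null_cylinder (B : set T) : measurable B -> mu B = 0 ->
  (mu \x lam) (B `*` setT) = 0.
Proof.
by move=> mB B0; rewrite product_measure1E//= B0 mul0e.
Qed.

End product_null.

Lemma cara_measurable_null_diff d (T : measurableType d) (R : realType)
    (m : {sigma_finite_measure set T -> \bar R}) (A B N : set T) :
  measurable B -> measurable N -> m N = 0%E -> A `+` B `<=` N ->
  (m^*)%mu.-cara.-measurable A.
Proof.
move=> mB mN N0 ABN.
have -> : A = (B `\` N) `|` (A `&` N).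
  apply/seteqP; split => x.
    move=> Ax; have [Nx|Nx] := pselect (N x); [by right|left; split => //].
    by apply: contrapT => Bx; apply/Nx/ABN; left.
  move=> [[Bx Nx]|[]//]; apply: contrapT => Ax.
  by apply/Nx/ABN; right.
apply: measurableU.
  by apply: cara_measurable; exact: measurableD.
suff : (@completed_measure_extension _ _ _ m).-negligible (A `&` N).
  exact: measure_is_complete_caratheodory.
exists N; split; [exact: cara_measurable| |by move=> x []].
by rewrite -[RHS]N0; exact: (measurable_mu_extE m).
Qed.

Section lebesgue_perimeter.
Local Open Scope ereal_scope.
Context {R : realType} {n : nat}.
Notation Rm := (measurableTypeR R).
Notation lam := (@lebesgue_measure R).
Notation muV := (lebesgue_measure_rV R n).
Notation N := (lebesgue_measure_rVR R n).
Variable s : R.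
Implicit Types A B E O : set ('rV[R]_n * Rm).

(** The completed measure is replaced by the product measure in the inner integral first, then in
    the outer one. *)
Lemma interaction_regular A A' B B' (D : set ('rV[R]_n * Rm)) :
  lebesgue_measurable A -> lebesgue_measurable B ->
  measurable A' -> measurable B' -> measurable D -> N D = 0 ->
  A `+` A' `<=` D -> B `+` B' `<=` D ->
  interaction s A B = kernel_interaction muV (riesz_kernel s) A' B'.
Proof.
move=> mA mB mA' mB' mD D0 AD BD.
pose f (p : ('rV[R]_n * Rm) * ('rV[R]_n * Rm)) : \bar R :=
  riesz_kernel s (p.1.1, p.2.1, (p.1.2 - p.2.2)%R).
have f0 p : 0 <= f p by exact: riesz_kernel_ge0.
have mf : measurable_fun setT f.
  apply: (measurableT_comp (measurable_riesz_kernel s)); apply: measurable_fun_pair.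
    by apply: measurable_fun_pair; apply: (measurableT_comp measurable_fst).
  by apply: measurable_funB; apply: (measurableT_comp measurable_snd).
have mfX X : measurable_fun setT (fun Y => f (X, Y)).
  by apply: (measurableT_comp mf); exact: pair1_measurable.
have inner X : \int[completed_lebesgue_measure_rVR R n]_(Y in B)
    ((euclidean_dist X Y `^ (n%:R + 1 + s))^-1)%:E = \int[N]_(Y in B') f (X, Y).
  exact: (ge0_integral_completed mB mB' mD D0 BD (mfX X) (fun Y => f0 (X, Y))).
rewrite /interaction; under eq_integral do rewrite inner.
(* Absorbing the indicator of B' into the integrand lets Tonelli give the measurability of the inner
   integral in X. *)
pose g (p : ('rV[R]_n * Rm) * ('rV[R]_n * Rm)) := (\1_B' p.2)%:E * f p.
have g0 p : 0 <= g p by rewrite mule_ge0// lee_fin.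
have mg : measurable_fun setT g.
  apply: emeasurable_funM => //; apply/measurable_EFinP.
  by apply: (measurableT_comp _ measurable_snd); exact: measurable_indic.
have gE X : \int[N]_(Y in B') f (X, Y) = \int[N]_Y g (X, Y).
  rewrite integral_mkcond; apply: eq_integral => Y _.
  by rewrite patchE /g/= indicE; case: ifPn => YB; rewrite ?mul1e ?mul0e.
apply: (ge0_integral_completed mA mA' mD D0 AD).
  rewrite (funext gE).
  exact: (@measurable_fun_fubini_tonelli_F _ _ _ _ _ N g mg g0).
by move=> X; apply: integral_ge0.
Qed.

Lemma Per_regular E E' O (D : set ('rV[R]_n * Rm)) :
  measurable E' -> measurable O -> measurable D -> N D = 0 ->
  E `+` E' `<=` D ->
  Per s E O = kernel_perimeter muV (riesz_kernel s) E' O.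
Proof.
move=> mE' mO mD D0 ED; have mCE' := measurableC mE'.
have mEO := measurableI _ _ mE' mO; have mCEO := measurableI _ _ mCE' mO.
have mDO := measurableD mE' mO; have mCDO := measurableD mCE' mO.
have EE x : ~ D x -> E x <-> E' x.
  move=> Dx; split => Ex; apply: contrapT => nEx; apply/Dx/ED; [by left|by right].
(* [F] is a Boolean combination: since E and E' agree off D, so do the sets built from them and O by
   the same combination. *)
have sub A B (F : Prop -> Prop -> Prop) : (forall x, A x = F (E x) (O x)) ->
    (forall x, B x = F (E' x) (O x)) -> A `+` B `<=` D.
  move=> HA HB x ABx; apply: contrapT => Dx.
  have EEx : E x = E' x by apply/propext; exact: EE.
  by case: ABx => -[]; rewrite HA HB EEx.
have s1 : (E `&` O) `+` (E' `&` O) `<=` D by exact: (sub _ _ (fun p q => p /\ q)).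
have s2 : (~` E `&` O) `+` (~` E' `&` O) `<=` D.
  exact: (sub _ _ (fun p q => ~ p /\ q)).
have s3 : (~` E `\` O) `+` (~` E' `\` O) `<=` D.
  exact: (sub _ _ (fun p q => ~ p /\ ~ q)).
have s4 : (E `\` O) `+` (E' `\` O) `<=` D by exact: (sub _ _ (fun p q => p /\ ~ q)).
have c1 : lebesgue_measurable (E `&` O) := cara_measurable_null_diff mEO mD D0 s1.
have c2 : lebesgue_measurable (~` E `&` O) := cara_measurable_null_diff mCEO mD D0 s2.
have c3 : lebesgue_measurable (~` E `\` O) := cara_measurable_null_diff mCDO mD D0 s3.
have c4 : lebesgue_measurable (E `\` O) := cara_measurable_null_diff mDO mD D0 s4.
rewrite /Per /kernel_perimeter.
by rewrite (interaction_regular c1 c2 mEO mCEO mD D0 s1 s2)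
  (interaction_regular c1 c3 mEO mCDO mD D0 s1 s3)
  (interaction_regular c4 c2 mDO mCEO mD D0 s4 s2).
Qed.

End lebesgue_perimeter.

(** * Slices of the given set over Omega and outside it *)

Section vertical_sections.
Local Open Scope ereal_scope.
Context {R : realType} {n : nat}.
Notation Rm := (measurableTypeR R).
Notation lam := (@lebesgue_measure R).
Variables (Omega : set 'rV[R]_n) (E E' D : set ('rV[R]_n * Rm)) (M : R).
Hypotheses (mE' : measurable E') (mD : measurable D).
Hypotheses (EE' : E `<=` E') (E'D : E' `\` E `<=` D).
Hypothesis Esub : is_subgraph_outside E Omega.
Hypothesis loE : Omega `*` `]-oo, (- M)%R[ `<=` E `&` (Omega `*` setT).
Hypothesis upE : E `&` (Omega `*` setT) `<=` Omega `*` `]-oo, M[.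
Let O : set ('rV[R]_n * Rm) := Omega `*` `](- M)%R, M[.

(** Over Omega the slice lies between the rays ending at -M and M, hence so does its height, and
    rearranging changes almost nothing outside ]-M, M[. Outside Omega the slice is the ray ending at
    v(x). *)
Lemma almost_ray_section x : lam (slice D x) = 0 ->
  vertical_height E x = slice_height E' x /\
  almost_ray (slice O x) (slice E' x).
Proof.
move=> D0; have mA' := measurable_slice x mE'; have mDx := measurable_slice x mD.
have AA' : slice E x `<=` slice E' x by move=> t; exact: EE'.
have A'D : slice E' x `\` slice E x `<=` slice D x by move=> t; exact: E'D.
have [Ox|nOx] := pselect (Omega x).
  have aA : ray (- M) `<=` slice E x.
    by move=> t tM; have [] := loE (conj Ox tM : (Omega `*` _) (x, t)).
  have Ab : slice E x `<=` ray M.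
    by move=> t Et; have [] := upE (conj Et (conj Ox I) : (E `&` _) (x, t)).
  have rA' := raylike_superset mA' mDx D0 AA' A'D aA Ab.
  split; first exact: (lim_height mA' mDx D0 AA' A'D aA Ab).
  split => //.
  have hlo := height_superset_ge mA' mDx D0 AA' A'D aA Ab.
  have hup := height_superset_le mA' mDx D0 AA' A'D aA Ab.
  have mr := measurable_ray (height (slice E' x)).
  have mOx : measurable (slice O x).
    rewrite (_ : slice O x = `](- M)%R, M[%classic); first exact: measurable_itv.
    by apply/seteqP; split => [t []//|t tM]; split.
  (* Outside ]-M, M[ two kinds of points may be affected: those above M, which E' contains only
     through a null set, and -M itself, which lies neither in O nor in the ray known to be in E. *)
  apply: (@subset_measure0 _ _ _ lam _
    ((slice E' x `\` ray M) `|` [set (- M)%R : Rm])).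
  - by apply: measurableD => //; exact: measurable_setY.
  - apply: measurableU; last exact: measurable_set1.
    by apply: measurableD => //; exact: measurable_ray.
  - move=> t [/= tE tO].
    have {}tO : ~ (- M < t < M)%R.
      by move=> tM; apply: tO; split => //=; rewrite in_itv.
    have [tM|tM] := eqVneq t (- M)%R; [by right|left].
    case: tE => -[]; rewrite /ray/= in_itv/=.
      move=> E't /negP; rewrite -leNgt => ht; split => //.
      apply/negP; rewrite -leNgt leNgt; apply/negP => tM'; apply: tO.
      by rewrite tM' andbT lt_neqAle eq_sym tM (le_trans hlo).
    move=> th nE't; exfalso.
    have [tlo|tlo] := ltP t (- M)%R.
      by apply: nE't; apply: AA'; apply: aA; rewrite /ray/= in_itv.
    apply: tO; rewrite lt_neqAle eq_sym tM tlo/=.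
    exact: lt_le_trans th hup.
  - apply: null_set_setU; last by rewrite [LHS]lebesgue_measure_set1.
    + by apply: measurableD => //; exact: measurable_ray.
    + exact: measurable_set1.
    + exact: (superset_setD_ray mA' mDx D0 A'D Ab).
have [v _ Ev] := Esub.
have AE : slice E x = ray (v x).
  apply/seteqP; split => t.
    move=> Et; have : (E `\` (Omega `*` setT)) (x, t) by split => // -[].
    by rewrite Ev /subgraph => -[_]; rewrite /ray/= in_itv.
  rewrite /ray/= in_itv/= => tv.
  by have : ((~` Omega `*` setT) `&` subgraph v) (x, t) by []; rewrite -Ev => -[].
(* Both bounding rays are taken equal to [ray (v x)], which forces the height to be v(x). *)
have aA : ray (v x) `<=` slice E x by rewrite AE.
have Ab : slice E x `<=` ray (v x) by rewrite AE.
split; first exact: (lim_height mA' mDx D0 AA' A'D aA Ab).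
split; first exact: (raylike_superset mA' mDx D0 AA' A'D aA Ab).
have hv : height (slice E' x) = v x.
  apply/eqP; rewrite eq_le (height_superset_le mA' mDx D0 AA' A'D aA Ab).
  exact: (height_superset_ge mA' mDx D0 AA' A'D aA Ab).
rewrite hv (_ : slice O x = set0); last by apply/seteqP; split => // t [].
rewrite setD0 measure_setY; [|exact: mA'|exact: measurable_ray].
rewrite /= (superset_setD_ray mA' mDx D0 A'D Ab) add0e (_ : _ `\` _ = set0) ?measure0//.
by apply/seteqP; split => // t [/aA/AA'].
Qed.

End vertical_sections.

Theorem theorem1p9 (R : realType) (n : nat) (s : R) (Omega : set 'rV[R]_n)
    (E : set ('rV[R]_n * R)) (M : R) :
  (1 <= n)%N ->
  0 < s < 1 ->
  open Omega ->
  bounded_set Omega ->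
  lebesgue_measurable E ->
  is_subgraph_outside E Omega ->
  0 < M ->
  Omega `*` `]-oo, (- M)[ `<=` E `&` (Omega `*` setT) ->
  E `&` (Omega `*` setT) `<=` Omega `*` `]-oo, M[ ->
  let E_star := subgraph (vertical_height E) in
  let O := (Omega `*` `](- M), M[) in
  (Per s E_star O <= Per s E O)%E /\
  ((Per s E O < +oo)%E -> ~ ae_equal E E_star ->
    (Per s E_star O < Per s E O)%E).
Proof.
move=> n0 _ oO bO mE Esub _ loE upE Es O.
pose Rm := measurableTypeR R.
(* Slicing works in the product sigma-algebra, so E is replaced by a Borel superset E' that exceeds
   it only inside the null set D0. *)
have [E' [D0 [mE' mD0 D00 EE' E'D0]]] :=
  @cara_measurable_regular _ _ _ (lebesgue_measure_rVR R n) E mE.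
have nD0 := product_null_slice mD0 D00.
have [B [mB B0 goodB]] := nD0.
have sec x : ~ B x -> vertical_height E x = slice_height E' x /\
    almost_ray (slice (O : set ('rV[R]_n * Rm)) x) (slice E' x).
  move=> Bx; have D0x : lebesgue_measure (slice D0 x) = 0%E.
    by apply: contrapT => D0x; apply/Bx/goodB.
  exact (almost_ray_section mE' mD0 EE' E'D0 Esub loE upE D0x).
pose E's : set ('rV[R]_n * Rm) := rearrangement E'.
have mE's : measurable E's by exact: measurable_rearrangement.
have mO : measurable (O : set ('rV[R]_n * Rm)).
  by apply: measurableX; [exact: open_measurable_rV|exact: measurable_itv].
pose D : set ('rV[R]_n * Rm) := D0 `|` (B `*` setT).
have mBT : measurable (B `*` setT : set ('rV[R]_n * Rm)) by exact: measurableX.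
have mD : measurable D by exact: measurableU.
have DN : lebesgue_measure_rVR R n D = 0%E.
  by apply: null_set_setU => //; exact: product_null_cylinder.
have ED : E `+` E' `<=` D.
  by move=> X [[/EE'//]|[E'X EX]]; left; exact: E'D0.
have EsD : Es `+` E's `<=` D.
  move=> [x t] EX; right; split => //; apply: contrapT => /sec[hx _].
  by case: EX => -[]; rewrite /Es /E's /subgraph /rearrangement/= hx.
rewrite (Per_regular s mE' mO mD DN ED) (Per_regular s mE's mO mD DN EsD).
have mk := measurable_riesz_kernel (n := n) s.
have k0 := riesz_kernel_ge0 (n := n) s.
have good : (lebesgue_measure_rV R n).-negligible
    (~` [set x | almost_ray (slice (O : set ('rV[R]_n * Rm)) x) (slice E' x)]).
  by exists B; split => // x /= nx; apply: contrapT => /sec[].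
split; first exact: kernel_perimeter_rearrangement_le.
move=> Pfin nae.
have [Y [mY Y0 YO]] := bounded_set_rV_disjoint n0 bO.
apply: (kernel_perimeter_rearrangement_lt mk k0 mE' mO good _ mY Y0) => //.
- by move=> x y h; exact: riesz_kernel_gt0.
- by move=> y /YO Oy; apply/seteqP; split => // t [].
(* If E' agreed with its rearrangement up to a null set, then adding D to that set would show the
   same for E. *)
- apply/eqP => EE0; apply: nae.
  exists (D `|` (E' `+` E's)); split.
  + apply: cara_measurable; apply: measurableU => //; exact: measurable_setY.
  + rewrite /completed_lebesgue_measure_rVR /completed_measure_extension.
    rewrite measurable_mu_extE; last first.
      by apply: measurableU => //; exact: measurable_setY.
    by apply: null_set_setU => //; exact: measurable_setY.
  + move=> X EX; have [|DX] := pselect (D X); first by left.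
    right; have EE'X : E X = E' X.
      apply/propext; split => ?; apply: contrapT => ?; apply/DX/ED;
        [by left|by right].
    have EsX : Es X = E's X.
      apply/propext; split => ?; apply: contrapT => ?; apply/DX/EsD;
        [by left|by right].
    by case: EX => -[] H1 H2; [left|right]; split; rewrite -?EE'X -?EsX.
Qed.
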